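(* There is a (lightface) $\Pi^0_2$ class $B\subseteq[0,1]\times[0,1]$ with Hausdorff dimension $1$, such that for every hyperarithmetic direction $\vec{e}$, the set $\mathrm{Proj}_{\vec{e}}(B)$ has Hausdorff dimension $0$.
   Context: A direction in $\mathbb{R}^2$ is a unit vector $\vec{e}$, i.e. a point of the unit circle $S^1\subseteq\mathbb{R}^2$. For $B\subseteq\mathbb{R}^2$ and a direction $\vec{e}$, $\mathrm{Proj}_{\vec{e}}(B)=\{p\cdot\vec{e} : p\in B\}\subseteq\mathbb{R}$, where $\cdot$ is the dot product. A set $B\subseteq[0,1]\times[0,1]$ is a $\Pi^0_2$ class (lightface) if $B=\bigcap_n O_n\cap([0,1]\times[0,1])$, where $(O_n)_{n\in\omega}$ is a uniformly computably enumerable sequence of effectively open subsets of $\mathbb{R}^2$ (each $O_n$ is the union of a set of open balls with rational centres and rational radii, these sets of balls being c.e. uniformly in $n$). A direction is hyperarithmetic if it is computable (as a point of $\mathbb{R}^2$, i.e. both coordinates are computable reals) relative to some hyperarithmetic set; equivalently, relative to $\emptyset^{(\alpha)}$ for some computable ordinal $\alpha$. *)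

(* Defs.v *)
From Stdlib Require Cantor.
From mathcomp Require Import all_boot all_order all_algebra.
From mathcomp Require Import all_classical all_reals all_analysis.

Set Implicit Arguments.
Unset Strict Implicit.
Unset Printing Implicit Defensive.

Import Order.TTheory GRing.Theory Num.Theory.

Local Open Scope classical_set_scope.

(* Oracle computability: mu-recursive functions on nat, with finite tuples
   coded by iterated Cantor pairing. *)

Definition npair (m n : nat) : nat := Cantor.to_nat (m, n).
Definition nfst (n : nat) : nat := (Cantor.of_nat n).1.
Definition nsnd (n : nat) : nat := (Cantor.of_nat n).2.

Inductive ocode : Type :=
| cZero | cSucc | cFst | cSnd | cOracle
| cPair of ocode & ocode
| cComp of ocode & ocode
| cPrec of ocode & ocode
| cMu of ocode.

(* [oeval X c n v]: the program [c] with oracle [X] halts on input [n] with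
   output [v].  In the [cPrec] clause, [r 0, ..., r (nsnd n)] are the successive
   values of the primitive recursion; [r] is unconstrained beyond them. *)
Fixpoint oeval (X : set nat) (c : ocode) (n v : nat) : Prop :=
  match c with
  | cZero => v = 0%N
  | cSucc => v = n.+1
  | cFst => v = nfst n
  | cSnd => v = nsnd n
  | cOracle => (X n /\ v = 1%N) \/ (~ X n /\ v = 0%N)
  | cPair a b => exists u w, [/\ oeval X a n u, oeval X b n w & v = npair u w]
  | cComp a b => exists u, oeval X b n u /\ oeval X a u v
  | cPrec a b => exists r : nat -> nat,
      [/\ oeval X a (nfst n) (r 0%N),
          forall k, (k < nsnd n)%N ->
            oeval X b (npair (nfst n) (npair k (r k))) (r k.+1)
        & v = r (nsnd n)]
  | cMu a => oeval X a (npair n v) 0%N /\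
      forall k, (k < v)%N -> exists u, oeval X a (npair n k) u.+1
  end.

(* Goedel numbering: a bijection between codes and natural numbers. *)
Fixpoint encode (c : ocode) : nat :=
  match c with
  | cZero => 0
  | cSucc => 1
  | cFst => 2
  | cSnd => 3
  | cOracle => 4
  | cPair a b => 5 + 4 * npair (encode a) (encode b)
  | cComp a b => 6 + 4 * npair (encode a) (encode b)
  | cPrec a b => 7 + 4 * npair (encode a) (encode b)
  | cMu a => 8 + 4 * encode a
  end.

(* [phi X e n v]: the [e]-th partial [X]-computable function maps [n] to [v]. *)
Definition phi (X : set nat) (e n v : nat) : Prop :=
  exists c, encode c = e /\ oeval X c n v.

Definition computable_fun (X : set nat) (f : nat -> nat) : Prop :=
  exists c, forall n, oeval X c n (f n).

Definition turing_le (A X : set nat) : Prop :=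
  exists c, forall n, (A n -> oeval X c n 1%N) /\ (~ A n -> oeval X c n 0%N).

Definition ce (W : set nat) : Prop :=
  exists c, forall n, W n <-> exists v, oeval set0 c n v.

Definition jump (X : set nat) : set nat := [set e | exists v, phi X e e v].

(* Kleene's system of ordinal notations and its order. *)
Inductive kleeneO : nat -> Prop :=
| kleeneO_zero : kleeneO 1
| kleeneO_succ a : kleeneO a -> kleeneO (2 ^ a)
| kleeneO_lim e (f : nat -> nat) :
    (forall n, phi set0 e n (f n)) ->
    (forall n, kleeneO (f n)) ->
    (forall n, ltO (f n) (f n.+1)) ->
    kleeneO (3 * 5 ^ e)
with ltO : nat -> nat -> Prop :=
| ltO_succ a : kleeneO a -> ltO a (2 ^ a)
| ltO_lim e n v : kleeneO (3 * 5 ^ e) -> phi set0 e n v -> ltO v (3 * 5 ^ e)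
| ltO_trans a b c : ltO a b -> ltO b c -> ltO a c.

(* [Hset a X]: [X] is the iterate of the Turing jump of the empty set along the
   notation [a] (for [a] in [kleeneO]; the H-set of [a]). *)
Inductive Hset : nat -> set nat -> Prop :=
| Hset_zero : Hset 1 set0
| Hset_succ a X : Hset a X -> Hset (2 ^ a) (jump X)
| Hset_lim e (f : nat -> nat) (Y : nat -> set nat) :
    (forall n, phi set0 e n (f n)) ->
    (forall n, Hset (f n) (Y n)) ->
    Hset (3 * 5 ^ e) [set z | Y (nfst z) (nsnd z)].

Definition hyperarithmetic (A : set nat) : Prop :=
  exists a H, [/\ kleeneO a, Hset a H & turing_le A H].

Local Open Scope ring_scope.

Section Plane.
Context {R : realType}.

(* Every rational number is [ratcode k] for some [k]. *)
Definition ratcode (k : nat) : R :=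
  ((nfst (nfst k))%:R - (nsnd (nfst k))%:R) / (nsnd k).+1%:R.

Definition computable_real (X : set nat) (x : R) : Prop :=
  exists f, computable_fun X f /\ forall n, `|x - ratcode (f n)| <= 2 ^- n.

Definition dist1 (x y : R) : R := `|x - y|.

(* The library metric on [R * R] is the sup metric; here it is Euclidean. *)
Definition dist2 (p q : R * R) : R :=
  Num.sqrt ((p.1 - q.1) ^+ 2 + (p.2 - q.2) ^+ 2).

(* Codes with nonpositive radius denote the empty set. *)
Definition rational_ball (k : nat) : set (R * R) :=
  [set p | dist2 p (ratcode (nfst (nfst k)), ratcode (nsnd (nfst k)))
           < ratcode (nsnd k)].

Definition unit_square : set (R * R) :=
  [set p | (0 <= p.1 <= 1) /\ (0 <= p.2 <= 1)].

Definition lightface_Pi02 (B : set (R * R)) : Prop :=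
  exists W : set nat, ce W /\
    B = (\bigcap_(n in [set: nat])
           \bigcup_(k in [set k | W (npair n k)]) rational_ball k)
        `&` unit_square.

Definition direction (e : R * R) : Prop := e.1 ^+ 2 + e.2 ^+ 2 = 1.

Definition hyperarithmetic_direction (e : R * R) : Prop :=
  direction e /\
  exists X, [/\ hyperarithmetic X, computable_real X e.1
              & computable_real X e.2].

Definition dirproj (e : R * R) (B : set (R * R)) : set R :=
  [set p.1 * e.1 + p.2 * e.2 | p in B].

End Plane.

Section Hausdorff.
Context {R : realType} {T : Type} (d : T -> T -> R).
Local Open Scope ereal_scope.

Definition diam (U : set T) : \bar R :=
  ereal_sup [set (d x y)%:E | x in U & y in U].

(* The empty set costs 0 for every [s]; a point costs 1 for [s = 0]. *)
Definition hcost (s : R) (U : set T) : \bar R :=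
  if U == set0 then 0 else poweR (diam U) s.

Definition hausdorff_premeasure (s delta : R) (A : set T) : \bar R :=
  ereal_inf [set \sum_(0 <= i <oo) hcost s (U i) | U in
    [set U : nat -> set T | A `<=` \bigcup_i U i /\
                            forall i, diam (U i) <= delta%:E]].

Definition hausdorff_measure (s : R) (A : set T) : \bar R :=
  ereal_sup [set hausdorff_premeasure s delta A
            | delta in [set delta : R | (0 < delta)%R]].

Definition hausdorff_dim (A : set T) : \bar R :=
  ereal_inf [set s%:E | s in
    [set s : R | (0 <= s)%R /\ hausdorff_measure s A = 0]].

End Hausdorff.

(* Main.v *)
From Stdlib Require Cantor.
Require Import Defs.
From mathcomp Require Import all_boot all_order all_algebra.
From mathcomp Require Import all_classical all_reals all_analysis.
From mathcomp Require Import zify ring lra.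

(* Bit v of an infinite binary sequence is read off a point p of the square at
   the scale 2^-mexp v of its first coordinate.  A countable conjunction of
   countable disjunctions over these bits forces some of them to be the
   H-sets along all notations, together with the graphs of all programs relative
   to them: arithmetic closure conditions suffice, since every sequence closed
   under jumps and effective joins contains the true H-sets, and the family of
   true H-sets is itself closed.  Further disjunctions let every pair (H-set,
   program) choose infinitely many stages j, and at a chosen stage put p.e within
   O(L^-1) of a multiple of 1/N, where e is the approximate direction computed by
   the program and L = N^(j+1).  All these disjunctions are effectively open, so
   they define a lightface Pi02 class B.

   For hyperarithmetic e the set Proj_e(B) thus consists of Liouville-like
   numbers, whose approximations do not depend on the point, and has dimension 0;
   the direction (1,0) also gives dim B <= 1.  Conversely, choose a slope lam
   outside the countable set of slopes that are limits of slopes computed by these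
   programs.  On each line p.2 - lam p.1 = t a nested interval argument then finds
   a point coding the true H-sets, so a Lipschitz map sends B onto an interval
   and dim B >= 1. *)

Set Implicit Arguments.
Unset Strict Implicit.
Unset Printing Implicit Defensive.

Import Order.TTheory GRing.Theory Num.Theory.
Local Open Scope classical_set_scope.

(** * Recursive functions *)

Lemma nfst_npair m n : nfst (npair m n) = m.
Proof. by rewrite /nfst /npair Cantor.cancel_of_to. Qed.

Lemma nsnd_npair m n : nsnd (npair m n) = n.
Proof. by rewrite /nsnd /npair Cantor.cancel_of_to. Qed.

Lemma npair_proj n : npair (nfst n) (nsnd n) = n.
Proof. by rewrite /npair /nfst /nsnd -surjective_pairing Cantor.cancel_to_of. Qed.

Definition npairE := (nfst_npair, nsnd_npair).

Lemma npair_inj a b c d : npair a b = npair c d -> a = c /\ b = d.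
Proof.
move=> h; split; first by rewrite -(nfst_npair a b) h nfst_npair.
by rewrite -(nsnd_npair a b) h nsnd_npair.
Qed.

Lemma npair_ge m n : (m <= npair m n)%N /\ (n <= npair m n)%N.
Proof.
have := Cantor.to_nat_non_decreasing m n; rewrite -/(npair m n) => h.
by split; apply/ssrnat.leP; lia.
Qed.

#[global] Opaque npair nfst nsnd.

Definition recursive (f : nat -> nat) := computable_fun set0 f.

Lemma recursive_id : recursive (fun x => x).
Proof.
exists (cPair cFst cSnd) => n /=; exists (nfst n), (nsnd n); split => //.
by rewrite npair_proj.
Qed.

Lemma recursive_comp f g : recursive f -> recursive g -> recursive (fun x => f (g x)).
Proof.
move=> [c hc] [d hd]; exists (cComp c d) => n /=; exists (g n); split; [exact: hd|exact: hc].
Qed.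

Lemma recursive_pair f g : recursive f -> recursive g ->
  recursive (fun x => npair (f x) (g x)).
Proof.
move=> [c hc] [d hd]; exists (cPair c d) => n /=; exists (f n), (g n); split; [exact: hc|exact: hd|by []].
Qed.

Lemma recursive_fst f : recursive f -> recursive (fun x => nfst (f x)).
Proof. by apply: recursive_comp; exists cFst. Qed.

Lemma recursive_snd f : recursive f -> recursive (fun x => nsnd (f x)).
Proof. by apply: recursive_comp; exists cSnd. Qed.

Lemma recursive_succ f : recursive f -> recursive (fun x => (f x).+1).
Proof. by apply: recursive_comp; exists cSucc. Qed.

Lemma recursive_const k : recursive (fun=> k).
Proof.
by elim: k => [|k /recursive_succ //]; exists cZero.
Qed.

(** [cPrec] carries [x] along as the first component of its input. The arithmetic closure lemmas and
    definition by cases below are instances of this one recursion. *)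
Lemma recursive_iteri k h g :
  recursive k -> recursive (fun z => h (nfst z) (nfst (nsnd z)) (nsnd (nsnd z))) ->
  recursive g -> recursive (fun x => iteri (k x) (h x) (g x)).
Proof.
move=> hk hh [cg hg]; case: hh => ch hh.
suff: recursive (fun y => iteri (nsnd y) (h (nfst y)) (g (nfst y))).
  move=> /recursive_comp /(_ (recursive_pair recursive_id hk)).
  by under eq_fun do rewrite !npairE.
exists (cPrec cg ch) => y /=.
exists (fun i => iteri i (h (nfst y)) (g (nfst y))); split => //= i _.
by have := hh (npair (nfst y) (npair i (iteri i (h (nfst y)) (g (nfst y))))); rewrite !npairE.
Qed.

Lemma eq_recursive f g : f =1 g -> recursive f -> recursive g.
Proof. by move=> /funext ->. Qed.

Lemma recursive_add f g : recursive f -> recursive g -> recursive (fun x => f x + g x)%N.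
Proof.
move=> hf hg.
apply: (@eq_recursive (fun x => iteri (f x) (fun _ r => r.+1) (g x))).
  by move=> x; elim: (f x) => //= n ->.
apply: recursive_iteri => //; apply/recursive_succ/recursive_snd/recursive_snd/recursive_id.
Qed.

Lemma recursive_mul f g : recursive f -> recursive g -> recursive (fun x => f x * g x)%N.
Proof.
move=> hf hg.
apply: (@eq_recursive (fun x => iteri (f x) (fun _ r => g x + r)%N 0%N)).
  by move=> x; elim: (f x) => //= n ->; rewrite mulSn.
apply: (@recursive_iteri f (fun x _ r => g x + r)%N (fun=> 0%N)) => //.
- apply: recursive_add; last exact/recursive_snd/recursive_snd/recursive_id.
  by apply: recursive_comp => //; exact/recursive_fst/recursive_id.
- exact: recursive_const.
Qed.

Lemma recursive_exp f g : recursive f -> recursive g -> recursive (fun x => f x ^ g x)%N.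
Proof.
move=> hf hg.
apply: (@eq_recursive (fun x => iteri (g x) (fun _ r => f x * r)%N 1%N)).
  by move=> x; elim: (g x) => //= n ->; rewrite expnS.
apply: (@recursive_iteri g (fun x _ r => f x * r)%N (fun=> 1%N)) => //.
- apply: recursive_mul; last exact/recursive_snd/recursive_snd/recursive_id.
  by apply: recursive_comp => //; exact/recursive_fst/recursive_id.
- exact: recursive_const.
Qed.

Lemma recursive_pred f : recursive f -> recursive (fun x => (f x).-1).
Proof.
move=> hf.
apply: (@eq_recursive (fun x => iteri (f x) (fun i _ => i) 0%N)).
  by move=> x; case: (f x).
apply: (@recursive_iteri f (fun x i _ => i) (fun=> 0%N)) => //.
- exact/recursive_fst/recursive_snd/recursive_id.
- exact: recursive_const.
Qed.

Lemma recursive_sub f g : recursive f -> recursive g -> recursive (fun x => f x - g x)%N.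
Proof.
move=> hf hg.
apply: (@eq_recursive (fun x => iteri (g x) (fun _ r => r.-1) (f x))).
  by move=> x; elim: (g x) => [|n /= ->]; rewrite ?subn0 // subnS.
apply: recursive_iteri => //; apply/recursive_pred/recursive_snd/recursive_snd/recursive_id.
Qed.

Definition decidable_pred (b : nat -> bool) := recursive (fun x => nat_of_bool (b x)).

Lemma recursive_if b f g : decidable_pred b -> recursive f -> recursive g ->
  recursive (fun x => if b x then f x else g x).
Proof.
move=> hb hf hg.
apply: (@eq_recursive (fun x => iteri (b x) (fun _ _ => f x) (g x))).
  by move=> x; case: (b x).
apply: (@recursive_iteri (fun x => nat_of_bool (b x)) (fun x _ _ => f x)) => //.
by apply: recursive_comp => //; exact/recursive_fst/recursive_id.
Qed.

Lemma decidable_leq f g : recursive f -> recursive g ->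
  decidable_pred (fun x => f x <= g x)%N.
Proof.
move=> hf hg; apply: (@eq_recursive (fun x => 1 - (f x - g x))%N).
  by move=> x; lia.
by apply: recursive_sub; [exact: recursive_const|exact: recursive_sub].
Qed.

Lemma decidable_and b c : decidable_pred b -> decidable_pred c ->
  decidable_pred (fun x => b x && c x).
Proof.
move=> hb hc; apply: (@eq_recursive (fun x => b x * c x)%N); last exact: recursive_mul.
by move=> x; case: (b x); case: (c x).
Qed.

Lemma decidable_not b : decidable_pred b -> decidable_pred (fun x => ~~ b x).
Proof.
move=> hb; apply: (@eq_recursive (fun x => 1 - b x)%N); first by move=> x; case: (b x).
exact/recursive_sub/hb/recursive_const.
Qed.

Lemma decidable_or b c : decidable_pred b -> decidable_pred c ->
  decidable_pred (fun x => b x || c x).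
Proof.
move=> hb hc; apply: (@eq_recursive (fun x => ~~ (~~ b x && ~~ c x))).
  by move=> x; case: (b x); case: (c x).
exact/decidable_not/decidable_and/decidable_not/hc/decidable_not.
Qed.

(** * Oracle programs and H-sets *)

Lemma oeval_fun X c n v w : oeval X c n v -> oeval X c n w -> v = w.
Proof.
elim: c n v w => [||||| a IHa b IHb|a IHa b IHb|a IHa b IHb|a IHa] n v w /=.
- by move=> -> ->.
- by move=> -> ->.
- by move=> -> ->.
- by move=> -> ->.
- by move=> [[x ->]|[x ->]] [[y ->]|[y ->]].
- by move=> [u1 [w1 [/IHa h1 /IHb h2 ->]]] [u2 [w2 [/h1 -> /h2 -> ->]]].
- by move=> [u1 [/IHb h2 /IHa h1]] [u2 [/h2 <- /h1]].
- move=> [r [r0 rS ->]] [s [s0 sS ->]].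
  suff h k : (k <= nsnd n)%N -> r k = s k by exact: h.
  elim: k => [_|k IHk kn]; first exact: IHa r0 s0.
  by have := rS k kn; rewrite IHk ?(ltnW kn)// => h; exact: IHb h (sS k kn).
- move=> [v0 vmin] [w0 wmin].
  case: (ltngtP v w) => // [/wmin|/vmin] [u /IHa].
  + by move=> /(_ _ v0).
  + by move=> /(_ _ w0).
Qed.

Lemma ce_range g : recursive g -> ce [set m | exists x, m = g x].
Proof.
move=> hg.
(* The semi-decision procedure searches for a preimage of m. [cMu] stops at the value 0, hence the
   negated equality test. *)
have : decidable_pred (fun y => ~~ ((g (nsnd y) <= nfst y) && (nfst y <= g (nsnd y))))%N.
  have h1 : recursive (fun y => g (nsnd y)) by exact/recursive_comp/recursive_snd/recursive_id.
  have h2 : recursive (fun y => nfst y) by exact/recursive_fst/recursive_id.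
  by apply/decidable_not/decidable_and; exact: decidable_leq.
under [X in decidable_pred X -> _]eq_fun do rewrite -eqn_leq.
move=> [c hc]; exists (cMu c) => m; split => /=.
  move=> [x mE]; have ex : exists x, m == g x by exists x; apply/eqP.
  case: (ex_minnP ex) => v mv vmin; exists v; split.
    by have := hc (npair m v); rewrite !npairE eq_sym mv.
  move=> k kv; exists 0%N; have := hc (npair m k); rewrite !npairE.
  by case: eqP => // mk; have := vmin k; rewrite -mk eqxx leqNgt kv => /(_ isT).
move=> [v [h _]]; exists v; move: h (hc (npair m v)); rewrite !npairE.
by case: eqP => // _ h1 h2; have := oeval_fun h1 h2.
Qed.

Lemma oeval_prec0 X a b m v : oeval X (cPrec a b) (npair m 0) v <-> oeval X a m v.
Proof.
split=> [[r []]|h]; first by rewrite !npairE => h _ ->.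
by exists (fun=> v); rewrite !npairE; split.
Qed.

Lemma oeval_precS X a b m k v : oeval X (cPrec a b) (npair m k.+1) v <->
  exists u, oeval X (cPrec a b) (npair m k) u /\ oeval X b (npair m (npair k u)) v.
Proof.
split=> [[r []]|[u [[r []]]]]; rewrite !npairE => r0 rS.
  move=> ->; exists (r k); split; last exact: rS.
  by exists r; rewrite !npairE; split => // i ik; apply: rS; exact: ltnW.
(* The given sequence is unconstrained beyond k, so it may be overwritten there by the new value. *)
move=> -> h; exists (fun i => if (i <= k)%N then r i else v); split; rewrite ?npairE ?ltnn//.
move=> i; rewrite ltnS => ik; rewrite ik; case: ifPn => [/rS //|].
by rewrite -leqNgt => ki; rewrite (_ : i = k) //; apply/eqP; rewrite eqn_leq ik.
Qed.

Lemma encode_inj : injective encode.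
Proof.
elim=> [||||| a IHa b IHb|a IHa b IHb|a IHa b IHb|a IHa]; case=> [||||| a' b'|a' b'|a' b'|a'] //= h;
  try (exfalso; lia).
- have [/IHa -> /IHb ->] // : encode a = encode a' /\ encode b = encode b' by apply: npair_inj; lia.
- have [/IHa -> /IHb ->] // : encode a = encode a' /\ encode b = encode b' by apply: npair_inj; lia.
- have [/IHa -> /IHb ->] // : encode a = encode a' /\ encode b = encode b' by apply: npair_inj; lia.
- by rewrite (IHa a') //; lia.
Qed.

Lemma encode_surj e : exists c, encode c = e.
Proof.
elim/ltn_ind: e => e IH.
case: (ltnP e 5) => e5.
  by case: e e5 {IH} => [|[|[|[|[|e]]]]] // _; [exists cZero|exists cSucc|exists cFst|exists cSnd|exists cOracle].
have [q eE] : exists q, [\/ e = 5 + 4 * q, e = 6 + 4 * q, e = 7 + 4 * q | e = 8 + 4 * q]%N.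
  exists ((e - 5) %/ 4)%N; have := divn_eq (e - 5) 4; have := ltn_mod (e - 5) 4.
  case: (_ %% _)%N => [|[|[|[|r]]]] //= _ h; [apply: Or41|apply: Or42|apply: Or43|apply: Or44]; lia.
have [h1 h2] := npair_ge (nfst q) (nsnd q); rewrite npair_proj in h1 h2.
have qe : (q < e)%N by case: eE; lia.
have [a aE] := IH _ (leq_ltn_trans h1 qe).
have [b bE] := IH _ (leq_ltn_trans h2 qe).
have [c cE] := IH _ qe.
case: eE => eE; rewrite eE; [exists (cPair a b)|exists (cComp a b)|exists (cPrec a b)|exists (cMu c)];
  by rewrite /= ?aE ?bE ?cE ?npair_proj.
Qed.

Lemma phiE X c n v : phi X (encode c) n v <-> oeval X c n v.
Proof. by split=> [[d [/encode_inj ->]]|h] //; exists c. Qed.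

Lemma phi_fun X e n v w : phi X e n v -> phi X e n w -> v = w.
Proof. by have [c <-] := encode_surj e; rewrite !phiE; exact: oeval_fun. Qed.

Fixpoint subst_oracle (o c : ocode) : ocode :=
  match c with
  | cOracle => o
  | cPair a b => cPair (subst_oracle o a) (subst_oracle o b)
  | cComp a b => cComp (subst_oracle o a) (subst_oracle o b)
  | cPrec a b => cPrec (subst_oracle o a) (subst_oracle o b)
  | cMu a => cMu (subst_oracle o a)
  | c => c
  end.

Lemma oeval_subst A H o : (forall n, (A n -> oeval H o n 1%N) /\ (~ A n -> oeval H o n 0%N)) ->
  forall c n v, oeval A c n v -> oeval H (subst_oracle o c) n v.
Proof.
move=> ho; elim=> [||||| a IHa b IHb|a IHa b IHb|a IHa b IHb|a IHa] n v //=.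
- by move=> [[h ->]|[h ->]]; have [h1 h2] := ho n; [exact: h1|exact: h2].
- by move=> [u [w [/IHa hu /IHb hw ->]]]; exists u, w.
- by move=> [u [/IHb hu /IHa hw]]; exists u.
- by move=> [r [/IHa r0 rS ->]]; exists r; split=> // k /rS /IHb.
- by move=> [/IHa h hk]; split=> // k /hk [u /IHa]; exists u.
Qed.

Lemma computable_fun_turing_le A H f : turing_le A H -> computable_fun A f -> computable_fun H f.
Proof. by move=> [d hd] [c hc]; exists (subst_oracle d c) => n; exact/(oeval_subst hd)/hc. Qed.

(** Since [2 ^ 0 = 1], positivity is what separates successor notations from the notation of
    zero. *)
Lemma Hset_gt0 a X : Hset a X -> (0 < a)%N.
Proof. by case=> [|b Y _|e f Y _ _]; rewrite ?muln_gt0 ?expn_gt0. Qed.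

Lemma Hset_inv a X : Hset a X ->
  [\/ a = 1%N /\ X = set0,
      exists b Y, [/\ a = (2 ^ b)%N, (0 < b)%N, Hset b Y & X = jump Y] |
      exists e f Y, [/\ a = (3 * 5 ^ e)%N, (forall n, phi set0 e n (f n)),
        (forall n, Hset (f n) (Y n)) & X = [set z | Y (nfst z) (nsnd z)]]].
Proof.
case=> [|b Y hb|e f Y hf hY]; first by apply: Or31.
- by apply: Or32; exists b, Y; split => //; exact: Hset_gt0 hb.
- by apply: Or33; exists e, f, Y; split.
Qed.

Lemma exp2_neq_3exp5 a e : (2 ^ a <> 3 * 5 ^ e)%N.
Proof.
move=> h; have : (3 %| 2 ^ a)%N by rewrite h dvdn_mulr.
by rewrite Euclid_dvdX //.
Qed.

Lemma exp2_neq1 a : (0 < a)%N -> (2 ^ a <> 1)%N.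
Proof. by case: a => // a _; rewrite expnS => h; lia. Qed.

Lemma exp35_inj e e' : (3 * 5 ^ e = 3 * 5 ^ e')%N -> e = e'.
Proof. by move/eqP; rewrite eqn_pmul2l // eqn_exp2l // => /eqP. Qed.

(** The three shapes of a notation are disjoint and determine their parameters, so a second
    derivation must follow the first one step by step. *)
Lemma Hset_uniq a X Y : Hset a X -> Hset a Y -> X = Y.
Proof.
move=> h; elim: h Y => {a X} [|a X hX IH|e f X hf hX IH] Y /Hset_inv [[]|[b [Z []]]|[e' [f' [Z []]]]] //.
- by move=> h b0; case: (exp2_neq1 b0).
- by move=> h; have := h; rewrite -(expn0 2) => /exp2_neq_3exp5.
- by move=> /(exp2_neq1 (Hset_gt0 hX)).
- by move=> /eqP; rewrite eqn_exp2l // => /eqP <- _ /IH -> ->.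
- by move=> /exp2_neq_3exp5.
- by move=> h; case: (@exp2_neq_3exp5 0 e); rewrite h.
- by move=> h; case: (@exp2_neq_3exp5 b e); rewrite h.
- move=> /exp35_inj <- hf' hZ ->; apply/funext => z.
  have hZ' : Hset (f (nfst z)) (Z (nfst z)) by rewrite (phi_fun (hf (nfst z)) (hf' (nfst z))).
  by rewrite /mkset (IH _ _ hZ').
Qed.

(** * The infinitary formula *)

(* With M = 2^mexp j, N = 2^nexp j and L = 2^kexp j: bit j is read at scale 1/M,
   stage j approximates multiples of 1/N up to O(1/L), which needs the direction
   to precision 2^-rprec j. *)

Definition mexp j := (2 ^ (j.+1 * j.+1))%N.
Definition nexp j := (2 * mexp j)%N.
Definition kexp j := (j.+1 * nexp j)%N.
Definition rprec j := (kexp j).+1.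

(* Literals: bit v is 0, bit v is 1, and "p.e is close to a multiple of 1/N at
   stage j" for the approximate direction e coded by q. *)
Definition neg v := npair 0 v.
Definition pos v := npair 1 v.
Definition grid j q := npair 2 (npair j q).

(* The intended reading of the bits.
   vD a: there is an H-set along a; vH a z: z belongs to it;
   vE a c n v: program c relative to it maps n to v;
   vS e n: phi_e(n) is undefined or has no H-set (a Skolem witness that 3 * 5^e
   is no notation);
   vQ a c n v: the unbounded search of c on n does not stop before v;
   vY j: stage j = <<a, c>, l> is chosen by the program c relative to H_a. *)
Definition vD a := npair 0 a.
Definition vH a z := npair 1 (npair a z).
Definition vE a c n v := npair 2 (npair a (npair c (npair n v))).
Definition vS e n := npair 3 (npair e n).
Definition vQ a c n v := npair 4 (npair a (npair c (npair n v))).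
Definition vY j := npair 5 j.

(* Named, and later made opaque, because conversion would compute with these
   unary numerals. *)
Definition oS a := (2 ^ a)%N.
Definition oL e := (3 * 5 ^ e)%N.
Definition nPair b c := (5 + 4 * npair b c)%N.
Definition nComp b c := (6 + 4 * npair b c)%N.
Definition nPrec b c := (7 + 4 * npair b c)%N.
Definition nMu b := (8 + 4 * b)%N.

(* Clause schemes: a, ..., g are universally quantified, and the disjunction runs
   over the listed literals and over w. *)
Definition clauses (a b c d e f g w : nat) : seq (seq nat) :=
  let pr := nPair b c in
  let cm := nComp b c in
  let pc := nPrec b c in
  let mu := nMu b in
  let lim := oL a in
  let j := npair (npair a b) c in
  [:: [:: pos (vD 1)];
      [:: neg (vH 1 a)];
      [:: neg (vD a); pos (vD (oS a))];
      [:: neg (vD a); neg (vH (oS a) b); pos (vE a b b w)];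
      [:: neg (vD a); pos (vH (oS a) b); neg (vE a b b c)];
      [:: pos (vD lim); pos (vS a w)];
      [:: neg (vS a b); neg (vE 1 a b c); neg (vD c)];
      [:: neg (vD lim); neg (vE 1 a b c); neg (vH lim (npair b d)); pos (vH c d)];
      [:: neg (vD lim); neg (vE 1 a b c); pos (vH lim (npair b d)); neg (vH c d)];
      [:: neg (vE a b c d); neg (vE a b c (d + e).+1)];
      [:: pos (vE a 0 b 0)];
      [:: pos (vE a 1 b b.+1)];
      [:: pos (vE a 2 b (nfst b))];
      [:: pos (vE a 3 b (nsnd b))];
      [:: neg (vH a b); pos (vE a 4 b 1)];
      [:: pos (vH a b); pos (vE a 4 b 0)];
      [:: neg (vE a b d e); neg (vE a c d f); pos (vE a pr d (npair e f))];
      [:: neg (vE a pr d e); pos (vE a b d (nfst e))];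
      [:: neg (vE a pr d e); pos (vE a c d (nsnd e))];
      [:: neg (vE a c d e); neg (vE a b e f); pos (vE a cm d f)];
      [:: neg (vE a cm d f); pos (vE a c d w)];
      [:: neg (vE a cm d f); neg (vE a c d e); pos (vE a b e f)];
      [:: neg (vE a b d f); pos (vE a pc (npair d 0) f)];
      [:: neg (vE a pc (npair d 0) f); pos (vE a b d f)];
      [:: neg (vE a pc (npair d e) f); neg (vE a c (npair d (npair e f)) g);
          pos (vE a pc (npair d e.+1) g)];
      [:: neg (vE a pc (npair d e.+1) g); pos (vE a pc (npair d e) w)];
      [:: neg (vE a pc (npair d e.+1) g); neg (vE a pc (npair d e) f);
          pos (vE a c (npair d (npair e f)) g)];
      [:: neg (vE a mu c d); pos (vE a b (npair c d) 0)];
      [:: neg (vE a mu c (d + e).+1); pos (vE a b (npair c d) w.+1)];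
      [:: pos (vQ a b c 0)];
      [:: neg (vQ a b c d); neg (vE a b (npair c d) e.+1); pos (vQ a b c d.+1)];
      [:: neg (vQ a b c d); neg (vE a b (npair c d) 0); pos (vE a mu c d)];
      [:: pos (vY (npair (npair a b) (c + w)))];
      [:: neg (vY j); neg (vE a b (rprec j) d); grid j d]].

(* The default is the head of the list, so that an index out of range does not
   weaken the disjunction. *)
Definition pick (l : seq nat) s := nth (head 0%N l) l s.

Definition proj i n := nfst (iter i nsnd n).

Definition clause_of (p w : nat) :=
  clauses (proj 0 p) (proj 1 p) (proj 2 p) (proj 3 p) (proj 4 p) (proj 5 p) (proj 6 p) w.

(** [n] codes the scheme and its universal variables, [w] the chosen disjunct and the existential
    witness, so the whole formula reads: for all n there is w. Scheme numbers out of range repeat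
    the first clause. *)
Definition lit n w :=
  pick (nth [:: pos (vD 1)] (clause_of (nsnd n) (nsnd w)) (nfst n)) (nfst w).

(** * Recursiveness of the clauses *)

Definition recursive_seq (l : nat -> seq nat) := forall d i, recursive d -> recursive i ->
  recursive (fun x => nth (d x) (l x) (i x)).

Lemma recursive_seq0 : recursive_seq (fun=> [::]).
Proof. by move=> d i hd hi; under eq_fun do rewrite nth_nil. Qed.

Lemma recursive_seqS f l : recursive f -> recursive_seq l ->
  recursive_seq (fun x => f x :: l x).
Proof.
move=> hf hl d i hd hi.
apply: (@eq_recursive (fun x => if (i x <= 0)%N then f x else nth (d x) (l x) (i x).-1)).
  by move=> x; case: (i x).
apply: recursive_if => //; first exact/decidable_leq/recursive_const.
exact/hl/recursive_pred.
Qed.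

(** The default [d x] is itself a list, so its recursiveness can only be expressed through its
    picked entries. *)
Definition recursive_seq2 (L : nat -> seq (seq nat)) := forall d t s, 
  (forall s, recursive s -> recursive (fun x => pick (d x) (s x))) ->
  recursive t -> recursive s ->
  recursive (fun x => pick (nth (d x) (L x) (t x)) (s x)).

Lemma recursive_seq20 : recursive_seq2 (fun=> [::]).
Proof. by move=> d t s hd ht hs; under eq_fun do rewrite nth_nil; exact: hd. Qed.

Lemma recursive_pick f l s : recursive f -> recursive_seq l -> recursive s ->
  recursive (fun x => pick (f x :: l x) (s x)).
Proof. by move=> hf hl hs; apply: (recursive_seqS hf hl). Qed.

Lemma recursive_seq2S f l L : recursive f -> recursive_seq l -> recursive_seq2 L ->
  recursive_seq2 (fun x => (f x :: l x) :: L x).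
Proof.
move=> hf hl hL d t s hd ht hs.
apply: (@eq_recursive (fun x => if (t x <= 0)%N then pick (f x :: l x) (s x) else
   pick (nth (d x) (L x) (t x).-1) (s x))).
  by move=> x; case: (t x).
apply: recursive_if; first exact/decidable_leq/recursive_const.
- exact: recursive_pick.
- by apply: hL => //; exact: recursive_pred.
Qed.


Ltac rec_tac := repeat first
  [ assumption
  | apply: recursive_id
  | apply: recursive_const
  | apply: recursive_fst
  | apply: recursive_snd
  | apply: recursive_pair
  | apply: recursive_add
  | apply: recursive_mul
  | apply: recursive_sub
  | apply: recursive_exp
  | apply: recursive_succ
  | apply: recursive_pred
  | apply: decidable_leq
  | apply: decidable_and
  | apply: decidable_or
  | apply: decidable_not
  | apply: recursive_if ].

Lemma recursive_mexp f : recursive f -> recursive (fun x => mexp (f x)).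
Proof. by move=> hf; rewrite /mexp; rec_tac. Qed.

Lemma recursive_nexp f : recursive f -> recursive (fun x => nexp (f x)).
Proof. by move=> /recursive_mexp hf; rewrite /nexp; rec_tac. Qed.

Lemma recursive_kexp f : recursive f -> recursive (fun x => kexp (f x)).
Proof. by move=> hf; have := recursive_nexp hf; rewrite /kexp => ?; rec_tac. Qed.

Lemma recursive_clauses a b c d e f g w :
  recursive a -> recursive b -> recursive c -> recursive d -> recursive e ->
  recursive f -> recursive g -> recursive w ->
  recursive_seq2 (fun x => clauses (a x) (b x) (c x) (d x) (e x) (f x) (g x) (w x)).
Proof.
move=> ha hb hc hd he hf hg hw.
have hk := recursive_kexp (recursive_pair (recursive_pair ha hb) hc).
rewrite /clauses /rprec /nPair /nComp /nPrec /nMu /oS /oL /pos /neg /vD /vH /vE /vS /vQ /vY /grid.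
repeat (apply: recursive_seq20 || apply: recursive_seq2S || apply: recursive_seq0
  || apply: recursive_seqS || rec_tac).
Qed.

Lemma recursive_lit n w : recursive n -> recursive w -> recursive (fun x => lit (n x) (w x)).
Proof.
move=> hn hw.
apply: (@recursive_clauses _ _ _ _ _ _ _ _ _ _ _ _ _ _ _ _
   (fun=> [:: pos (vD 1)]) (fun x => nfst (n x)) (fun x => nfst (w x))).
all: rewrite /proj /=; try by rec_tac.
move=> s hs; apply: recursive_pick => //; [exact: recursive_const|exact: recursive_seq0].
Qed.


(** * The intended model *)

Definition Hstar a : set nat := [set z | exists2 X, Hset a X & X z].

Lemma HstarE a X : Hset a X -> Hstar a = X.
Proof.
by move=> hX; apply/seteqP; split=> [z [Y /Hset_uniq /(_ hX) ->]|z hz] //; exists X.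
Qed.

Lemma Hstar1 : Hstar 1 = set0.
Proof. exact: HstarE Hset_zero. Qed.

Lemma HstarS a : (exists X, Hset a X) -> Hstar (oS a) = jump (Hstar a).
Proof. by move=> [X hX]; rewrite (HstarE hX); apply: HstarE; exact: Hset_succ. Qed.

Lemma Hstar_lim e n m z : (exists X, Hset (oL e) X) -> phi set0 e n m ->
  Hstar (oL e) (npair n z) <-> Hstar m z.
Proof.
move=> [X hX] hm; rewrite (HstarE hX).
case/Hset_inv: hX => [[] h|[b [Y [h]]]|[e' [f [Y [/exp35_inj <- hf hY ->]]]]].
- by case: (@exp2_neq_3exp5 0 e (esym h)).
- by case: (@exp2_neq_3exp5 b e (esym h)).
- by rewrite /= !npairE (phi_fun hm (hf n)) (HstarE (hY n)).
Qed.

Section ModelDef.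
Variable active : nat -> Prop.

(** [active] stays a parameter because the stages that can be chosen depend on the slope of the line
    on which the point is sought. *)
Definition model v : Prop :=
  let x := nsnd v in
  match nfst v with
  | 0 => exists X, Hset x X
  | 1 => Hstar (nfst x) (nsnd x)
  | 2 => phi (Hstar (nfst x)) (nfst (nsnd x)) (nfst (nsnd (nsnd x))) (nsnd (nsnd (nsnd x)))
  | 3 => forall m, phi set0 (nfst x) (nsnd x) m -> ~ exists X, Hset m X
  | 4 => forall k, (k < nsnd (nsnd (nsnd x)))%N -> exists u,
      phi (Hstar (nfst x)) (nfst (nsnd x)) (npair (nfst (nsnd (nsnd x))) k) u.+1
  | _ => active x
  end.

Lemma modelD a : model (vD a) = exists X, Hset a X.
Proof. by rewrite /model /vD !npairE. Qed.
Lemma modelH a z : model (vH a z) = Hstar a z.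
Proof. by rewrite /model /vH !npairE. Qed.
Lemma modelE a c n v : model (vE a c n v) = phi (Hstar a) c n v.
Proof. by rewrite /model /vE !npairE. Qed.
Lemma modelS e n : model (vS e n) = forall m, phi set0 e n m -> ~ exists X, Hset m X.
Proof. by rewrite /model /vS !npairE. Qed.
Lemma modelQ a c n v : model (vQ a c n v) =
  forall k, (k < v)%N -> exists u, phi (Hstar a) c (npair n k) u.+1.
Proof. by rewrite /model /vQ !npairE. Qed.
Lemma modelY j : model (vY j) = active j.
Proof. by rewrite /model /vY !npairE. Qed.
Definition modelsE := (modelD, modelH, modelE, modelS, modelQ, modelY).

End ModelDef.

Lemma phi_pair X b c n v : phi X (nPair b c) n v <->
  exists u w, [/\ phi X b n u, phi X c n w & v = npair u w].
Proof.
have [b' <-] := encode_surj b; have [c' <-] := encode_surj c.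
rewrite -[nPair _ _]/(encode (cPair b' c')) phiE /=.
by split=> -[u [w [/phiE hu /phiE hw ->]]]; exists u, w.
Qed.

Lemma phi_comp X b c n v : phi X (nComp b c) n v <->
  exists u, phi X c n u /\ phi X b u v.
Proof.
have [b' <-] := encode_surj b; have [c' <-] := encode_surj c.
rewrite -[nComp _ _]/(encode (cComp b' c')) phiE /=.
by split=> -[u [/phiE hu /phiE hv]]; exists u.
Qed.

Lemma phi_prec0 X b c m v : phi X (nPrec b c) (npair m 0) v <-> phi X b m v.
Proof.
have [b' <-] := encode_surj b; have [c' <-] := encode_surj c.
by rewrite -[nPrec _ _]/(encode (cPrec b' c')) !phiE oeval_prec0.
Qed.

Lemma phi_precS X b c m k v : phi X (nPrec b c) (npair m k.+1) v <->
  exists u, phi X (nPrec b c) (npair m k) u /\ phi X c (npair m (npair k u)) v.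
Proof.
have [b' <-] := encode_surj b; have [c' <-] := encode_surj c.
rewrite -[nPrec _ _]/(encode (cPrec b' c')) phiE oeval_precS.
by split=> -[u [/phiE hu /phiE hv]]; exists u.
Qed.

Lemma phi_mu X b n v : phi X (nMu b) n v <->
  phi X b (npair n v) 0 /\ forall k, (k < v)%N -> exists u, phi X b (npair n k) u.+1.
Proof.
have [b' <-] := encode_surj b.
rewrite -[nMu _]/(encode (cMu b')) phiE /= phiE.
by split=> -[hv hk]; split=> // k /hk [u /phiE hu]; exists u.
Qed.

Opaque oS oL nPair nComp nPrec nMu neg pos grid vD vH vE vS vQ vY.

(** * Points satisfying the formula compute all H-sets *)

Lemma clause_of_tuple (a b c d e f g : nat) :
  let p := npair a (npair b (npair c (npair d (npair e (npair f (npair g 0)))))) in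
  forall w, clause_of p w = clauses a b c d e f g w.
Proof. by move=> p w; rewrite /clause_of /proj /= !npairE. Qed.

Lemma pick_ind (h : nat -> Prop) l s : ~~ nilp l -> h (pick l s) ->
  foldr (fun x P => h x \/ P) False l.
Proof.
case: l => // x l _; rewrite /pick /=.
have H : forall l' d, (forall s, h (nth d l' s) -> h d \/ foldr (fun x P => h x \/ P) False l').
  elim=> [|y l' IH] d [|s'] /=; [by left|by left|by right; left|].
  by move=> /IH [|]; [left|right; right].
by case: s => [|s] /=; [left|move=> /H].
Qed.

Lemma pick_intro (h : nat -> Prop) l : foldr (fun x P => h x \/ P) False l ->
  exists s, h (pick l s).
Proof.
suff H d : foldr (fun x P => h x \/ P) False l -> exists s, h (nth d l s) by exact: H.
elim: l => //= x l IH [hx|/IH [s hs]]; first by exists 0%N.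
by exists s.+1.
Qed.

Lemma encode_pair b c : encode (cPair b c) = nPair (encode b) (encode c).
Proof. by []. Qed.
Lemma encode_comp b c : encode (cComp b c) = nComp (encode b) (encode c).
Proof. by []. Qed.
Lemma encode_prec b c : encode (cPrec b c) = nPrec (encode b) (encode c).
Proof. by []. Qed.
Lemma encode_mu b : encode (cMu b) = nMu (encode b).
Proof. by []. Qed.

(** [h l] stands for: the point satisfies the literal [l]. A point may satisfy neither [neg v] nor
    [pos v]; the set read off is that of all [v] with [h (pos v)], and an undecided bit counts as
    0. *)
Section ClauseConsequences.
Variables (h : nat -> Prop).
Hypothesis consistent : forall v, h (neg v) -> ~ h (pos v).
Hypothesis sat : forall n, exists w, h (lit n w).

Local Notation T v := (h (pos v)).

Lemma sat_clause t a b c d e f g : exists w,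
  ~~ nilp (nth [:: pos (vD 1)] (clauses a b c d e f g w) t) ->
  foldr (fun x P => h x \/ P) False (nth [:: pos (vD 1)] (clauses a b c d e f g w) t).
Proof.
set p := npair a (npair b (npair c (npair d (npair e (npair f (npair g 0)))))).
have [w hw] := sat (npair t p).
exists (nsnd w); move: hw; rewrite /lit !npairE clause_of_tuple => hw ne.
exact: pick_ind hw.
Qed.

Ltac clause t a b c d e f g :=
  have [w /= /(_ isT)] := sat_clause t a b c d e f g.

Ltac clause_tac :=
  repeat match goal with
  | |- (h (neg ?v) \/ _) -> _ => case=> [/consistent|]
  | |- (h (pos ?v) \/ _) -> _ => case=> [|]
  | |- False -> _ => case
  | |- _ => intro
  end; try solve [by [] | eexists; eassumption | left; eexists; eassumption | right; eexists; eassumption | by left | by right | tauto].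

Lemma TD1 : T (vD 1).
Proof.
by clause 0%N 0%N 0%N 0%N 0%N 0%N 0%N 0%N; clause_tac.
Qed.

Lemma nTH1 z : T (vH 1 z) -> False.
Proof.
move=> h0; by clause 1%N z 0%N 0%N 0%N 0%N 0%N 0%N; clause_tac.
Qed.

Lemma TD2 a : T (vD a) -> T (vD (oS a)).
Proof.
move=> h0; by clause 2%N a 0%N 0%N 0%N 0%N 0%N 0%N; clause_tac.
Qed.

Lemma TjumpE a e : T (vD a) -> T (vH (oS a) e) -> exists v, T (vE a e e v).
Proof.
move=> h0 h1; by clause 3%N a e 0%N 0%N 0%N 0%N 0%N; clause_tac.
Qed.

Lemma TjumpI a e v : T (vD a) -> T (vE a e e v) -> T (vH (oS a) e).
Proof.
move=> h0 h1; by clause 4%N a e v 0%N 0%N 0%N 0%N; clause_tac.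
Qed.

Lemma TDlim e : T (vD (oL e)) \/ exists n, T (vS e n).
Proof.
by clause 5%N e 0%N 0%N 0%N 0%N 0%N 0%N; clause_tac.
Qed.

Lemma nTS e n m : T (vS e n) -> T (vE 1 e n m) -> T (vD m) -> False.
Proof.
move=> h0 h1 h2; by clause 6%N e n m 0%N 0%N 0%N 0%N; clause_tac.
Qed.

Lemma TlimE e n m z : T (vD (oL e)) -> T (vE 1 e n m) -> T (vH (oL e) (npair n z)) -> T (vH m z).
Proof.
move=> h0 h1 h2; by clause 7%N e n m z 0%N 0%N 0%N; clause_tac.
Qed.

Lemma TlimI e n m z : T (vD (oL e)) -> T (vE 1 e n m) -> T (vH m z) -> T (vH (oL e) (npair n z)).
Proof.
move=> h0 h1 h2; by clause 8%N e n m z 0%N 0%N 0%N; clause_tac.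
Qed.

Lemma TE_lt a c n v d : T (vE a c n v) -> T (vE a c n (v + d).+1) -> False.
Proof.
move=> h0 h1; by clause 9%N a c n v d 0%N 0%N; clause_tac.
Qed.

Lemma Tzero a n : T (vE a 0 n 0).
Proof.
by clause 10%N a n 0%N 0%N 0%N 0%N 0%N; clause_tac.
Qed.

Lemma Tsucc a n : T (vE a 1 n n.+1).
Proof.
by clause 11%N a n 0%N 0%N 0%N 0%N 0%N; clause_tac.
Qed.

Lemma Tfst a n : T (vE a 2 n (nfst n)).
Proof.
by clause 12%N a n 0%N 0%N 0%N 0%N 0%N; clause_tac.
Qed.

Lemma Tsnd a n : T (vE a 3 n (nsnd n)).
Proof.
by clause 13%N a n 0%N 0%N 0%N 0%N 0%N; clause_tac.
Qed.

Lemma Toracle1 a n : T (vH a n) -> T (vE a 4 n 1).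
Proof.
move=> h0; by clause 14%N a n 0%N 0%N 0%N 0%N 0%N; clause_tac.
Qed.

Lemma Toracle0 a n : T (vH a n) \/ T (vE a 4 n 0).
Proof.
by clause 15%N a n 0%N 0%N 0%N 0%N 0%N; clause_tac.
Qed.

Lemma TpairI a b c n u v : T (vE a b n u) -> T (vE a c n v) -> T (vE a (nPair b c) n (npair u v)).
Proof.
move=> h0 h1; by clause 16%N a b c n u v 0%N; clause_tac.
Qed.

Lemma TpairE1 a b c n v : T (vE a (nPair b c) n v) -> T (vE a b n (nfst v)).
Proof.
move=> h0; by clause 17%N a b c n v 0%N 0%N; clause_tac.
Qed.

Lemma TpairE2 a b c n v : T (vE a (nPair b c) n v) -> T (vE a c n (nsnd v)).
Proof.
move=> h0; by clause 18%N a b c n v 0%N 0%N; clause_tac.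
Qed.

Lemma TcompI a b c n u v : T (vE a c n u) -> T (vE a b u v) -> T (vE a (nComp b c) n v).
Proof.
move=> h0 h1; by clause 19%N a b c n u v 0%N; clause_tac.
Qed.

Lemma TcompE1 a b c n v : T (vE a (nComp b c) n v) -> exists u, T (vE a c n u).
Proof.
move=> h0; by clause 20%N a b c n 0%N v 0%N; clause_tac.
Qed.

Lemma TcompE2 a b c n u v : T (vE a (nComp b c) n v) -> T (vE a c n u) -> T (vE a b u v).
Proof.
move=> h0 h1; by clause 21%N a b c n u v 0%N; clause_tac.
Qed.

Lemma Tprec0I a b c m v : T (vE a b m v) -> T (vE a (nPrec b c) (npair m 0) v).
Proof.
move=> h0; by clause 22%N a b c m 0%N v 0%N; clause_tac.
Qed.

Lemma Tprec0E a b c m v : T (vE a (nPrec b c) (npair m 0) v) -> T (vE a b m v).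
Proof.
move=> h0; by clause 23%N a b c m 0%N v 0%N; clause_tac.
Qed.

Lemma TprecSI a b c m k u v : T (vE a (nPrec b c) (npair m k) u) -> T (vE a c (npair m (npair k u)) v) -> T (vE a (nPrec b c) (npair m k.+1) v).
Proof.
move=> h0 h1; by clause 24%N a b c m k u v; clause_tac.
Qed.

Lemma TprecSE1 a b c m k v : T (vE a (nPrec b c) (npair m k.+1) v) -> exists u, T (vE a (nPrec b c) (npair m k) u).
Proof.
move=> h0; by clause 25%N a b c m k 0%N v; clause_tac.
Qed.

Lemma TprecSE2 a b c m k u v : T (vE a (nPrec b c) (npair m k.+1) v) -> T (vE a (nPrec b c) (npair m k) u) -> T (vE a c (npair m (npair k u)) v).
Proof.
move=> h0 h1; by clause 26%N a b c m k u v; clause_tac.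
Qed.

Lemma TmuE1 a b n v : T (vE a (nMu b) n v) -> T (vE a b (npair n v) 0).
Proof.
move=> h0; by clause 27%N a b n v 0%N 0%N 0%N; clause_tac.
Qed.

Lemma TmuE2 a b n v d : T (vE a (nMu b) n (v + d).+1) -> exists u, T (vE a b (npair n v) u.+1).
Proof.
move=> h0; by clause 28%N a b n v d 0%N 0%N; clause_tac.
Qed.

Lemma TQ0 a b n : T (vQ a b n 0).
Proof.
by clause 29%N a b n 0%N 0%N 0%N 0%N; clause_tac.
Qed.

Lemma TQS a b n v u : T (vQ a b n v) -> T (vE a b (npair n v) u.+1) -> T (vQ a b n v.+1).
Proof.
move=> h0 h1; by clause 30%N a b n v u 0%N 0%N; clause_tac.
Qed.

Lemma TmuI a b n v : T (vQ a b n v) -> T (vE a b (npair n v) 0) -> T (vE a (nMu b) n v).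
Proof.
move=> h0 h1; by clause 31%N a b n v 0%N 0%N 0%N; clause_tac.
Qed.

Lemma TY a c k : exists l, T (vY (npair (npair a c) (k + l))).
Proof.
by clause 32%N a c k 0%N 0%N 0%N 0%N; clause_tac.
Qed.

Lemma TYgrid a c l q : T (vY (npair (npair a c) l)) -> T (vE a c (rprec (npair (npair a c) l)) q) -> h (grid (npair (npair a c) l) q).
Proof.
move=> h0 h1; by clause 33%N a c l q 0%N 0%N 0%N; clause_tac.
Qed.


Lemma TE_fun a c n v w : T (vE a c n v) -> T (vE a c n w) -> v = w.
Proof.
wlog vw : v w / (v <= w)%N.
  by move=> H; case/orP: (leq_total v w) => hvw hv hw; [|symmetry]; exact: H hvw _ _.
move=> hv; rewrite -(subnKC vw); case: (w - v)%N => [|d]; first by rewrite addn0.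
by rewrite addnS => /(TE_lt hv).
Qed.

(** The program clauses are not guarded by [vD a], so this holds for every [a] and for whatever set
    the bits [vH a] describe. Each constructor has clauses for both implications. *)
Lemma TE_oeval a c n v :
  T (vE a (encode c) n v) <-> oeval [set z | T (vH a z)] c n v.
Proof.
elim: c n v => [||||| b IHb c IHc|b IHb c IHc|b IHb c IHc|b IHb] n v.
- rewrite /=; by split=> [/TE_fun /(_ (Tzero a n))|->] //; exact: Tzero.
- rewrite /=; by split=> [/TE_fun /(_ (Tsucc a n))|->] //; exact: Tsucc.
- rewrite /=; by split=> [/TE_fun /(_ (Tfst a n))|->] //; exact: Tfst.
- rewrite /=; by split=> [/TE_fun /(_ (Tsnd a n))|->] //; exact: Tsnd.
- rewrite /=; split=> [h0|[[h0 ->]|[h0 ->]]].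
  + case: (pselect (T (vH a n))) => hH; [left|right]; split=> //.
      by apply: TE_fun h0 _; exact: Toracle1.
    by have [//|h1] := Toracle0 a n; exact: TE_fun h0 h1.
  + exact: Toracle1.
  + by have [|] := Toracle0 a n.
- rewrite encode_pair /=; split=> [h0|[u [w [/IHb h1 /IHc h2 ->]]]]; last exact: TpairI.
  exists (nfst v), (nsnd v); rewrite npair_proj; split=> //.
  + by apply/IHb; exact: TpairE1 h0.
  + by apply/IHc; exact: TpairE2 h0.
- rewrite encode_comp /=; split=> [h0|[u [/IHc h1 /IHb h2]]]; last exact: TcompI h1 h2.
  have [u hu] := TcompE1 h0; exists u; split; first exact/IHc.
  by apply/IHb; exact: TcompE2 h0 hu.
- rewrite encode_prec; rewrite -(npair_proj n); move: (nfst n) (nsnd n) => {n} m k.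
  elim: k v => [|k IHk] v.
    by rewrite oeval_prec0 -IHb; split=> [/Tprec0E|/Tprec0I].
  rewrite oeval_precS; split=> [h0|[u [/IHk h1 /IHc h2]]]; last exact: TprecSI h1 h2.
  have [u hu] := TprecSE1 h0; exists u; split; first exact/IHk.
  by apply/IHc; exact: TprecSE2 h0 hu.
- rewrite encode_mu /=; split=> [h0|[/IHb h0 hk]].
    split; first by apply/IHb; exact: TmuE1.
    move=> k kv; have [u hu] : exists u, T (vE a (encode b) (npair n k) u.+1).
      apply: (@TmuE2 a (encode b) n k (v - k.+1)).
      by rewrite (_ : (k + (v - k.+1)).+1 = v) //; lia.
    by exists u; apply/IHb.
  (* A clause has boundedly many literals, so the condition on all k < v is collected one value at a
     time in [vQ]. *)
  apply: (fun hQ => TmuI hQ h0); elim: {h0}v hk => [_|v IHv hk]; first exact: TQ0.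
  have [u /IHb hu] := hk v (ltnSn v).
  by apply: TQS hu; apply: IHv => k kv; apply: hk; exact: ltnW.
Qed.

Lemma TE_phi a e n v : T (vE a e n v) <-> phi [set z | T (vH a z)] e n v.
Proof. by have [c <-] := encode_surj e; rewrite phiE TE_oeval. Qed.

Lemma TH1 : [set z | T (vH 1 z)] = set0.
Proof. by apply/seteqP; split=> z //= /nTH1. Qed.

Lemma TE1_phi e n v : T (vE 1 e n v) <-> phi set0 e n v.
Proof. by rewrite TE_phi TH1. Qed.

(** The closure clauses follow a derivation of [Hset] upwards. Nothing is claimed about an [a]
    without an H-set, even if the point satisfies [pos (vD a)]. *)
Lemma TH_Hset a X : Hset a X -> T (vD a) /\ [set z | T (vH a z)] = X.
Proof.
elim=> {a X} [|a X _ [Da Ha]|e f X hf _ IH]; rewrite -?/(oS _) -?/(oL _).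
- by split; [exact: TD1|exact: TH1].
- split; first exact: TD2.
  apply/seteqP; split=> e /=.
    by move=> /(TjumpE Da) [v /TE_phi]; rewrite Ha; exists v.
  by move=> [v]; rewrite -Ha => /TE_phi hv; exact: (TjumpI Da hv).
- have De : T (vD (oL e)).
    (* The alternative to [vD] is a Skolem witness n denying that the n-th term is a notation, which
       the induction hypothesis for [f n] refutes. *)
    have [//|[n hn]] := TDlim e.
    by have [Dn _] := IH n; have /TE1_phi hE := hf n; case: (nTS hn hE Dn).
  split=> //; apply/seteqP; split=> z /=; have [_ Hn] := IH (nfst z);
    have /TE1_phi hE := hf (nfst z).
    by rewrite -Hn -{1}(npair_proj z) => hz; exact: (TlimE De hE hz).
  by rewrite -Hn => hz; rewrite -(npair_proj z); exact: (TlimI De hE hz).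
Qed.

(** The stages depend on the point, but the vector [f (rprec j)] used at stage j does not; this
    makes one cover serve all points. Stages are unbounded because pairing dominates its
    components. *)
Lemma grid_infinitely_often a X c f : Hset a X -> (forall n, oeval X c n (f n)) ->
  forall k, exists2 j, (k <= j)%N & h (grid j (f (rprec j))).
Proof.
move=> /TH_Hset [_ <-] hc k; have [l hl] := TY a (encode c) k.
exists (npair (npair a (encode c)) (k + l)).
  by have [_] := npair_ge (npair a (encode c)) (k + l)%N; apply: leq_trans; exact: leq_addr.
by have /TE_oeval hE := hc (rprec (npair (npair a (encode c)) (k + l))); exact: (TYgrid hl hE).
Qed.

End ClauseConsequences.

(** * The true H-sets satisfy the formula *)

Section Model.
Variables (h : nat -> Prop) (active : nat -> Prop).
Local Notation model := (model active).

Hypothesis hpos : forall v, model v -> h (pos v).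
Hypothesis hneg : forall v, ~ model v -> h (neg v).
Hypothesis active_infinitely_often :
  forall a c k, exists l, active (npair (npair a c) (k + l)).
Hypothesis active_grid : forall a c l q, let j := npair (npair a c) l in
  active j -> phi (Hstar a) c (rprec j) q -> h (grid j q).

Lemma or_neg v P : (model v -> P) -> h (neg v) \/ P.
Proof. by move=> hP; case: (pselect (model v)) => [/hP|/hneg]; [right|left]. Qed.

Lemma or_pos v P : model v -> h (pos v) \/ P.
Proof. by move=> /hpos; left. Qed.

Lemma or_posC v P : (~ model v -> P) -> h (pos v) \/ P.
Proof. by move=> hP; case: (pselect (model v)) => [/hpos|/hP]; [left|right]. Qed.



Ltac model_tac :=
  repeat match goal with
  | |- h (neg _) \/ _ => apply: or_neg; rewrite ?modelsE; intro
  end.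

Lemma model_clauses t a b c d e f g : exists w,
  foldr (fun x P => h x \/ P) False (nth [:: pos (vD 1)] (clauses a b c d e f g w) t).
Proof.
case: t => [|[|[|[|[|[|[|[|[|[|[|[|[|[|[|[|[|[|[|[|[|[|[|[|[|[|[|[|[|[|[|[|[|[|t]]]]]]]]]]]]]]]]]]]]]]]]]]]]]]]]]]; rewrite /=.
- by exists 0%N; apply: or_pos; rewrite modelsE; exists set0; exact: Hset_zero.
- by exists 0%N; model_tac; move: H; rewrite Hstar1.
- exists 0%N; model_tac; apply: or_pos; rewrite modelsE.
  by case: H => X hX; exists (jump X); exact: Hset_succ.
- case: (pselect (exists v, phi (Hstar a) b b v)) => [[w hw]|hn]; [exists w|exists 0%N]; model_tac.
    by apply: or_pos; rewrite modelsE.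
  by case: hn; move: H0; rewrite (HstarS H).
- exists 0%N; model_tac; apply: or_posC; rewrite modelsE (HstarS H) => hn; left; apply: hneg.
  by rewrite modelsE => hc; apply: hn; exists c.
- case: (pselect (exists X, Hset (oL a) X)) => hD.
    by exists 0%N; apply: or_pos; rewrite modelsE.
  suff [n hn] : exists n, forall m, phi set0 a n m -> ~ exists X, Hset m X.
    by exists n; right; apply: or_pos; rewrite modelsE.
  (* If every n had a value with an H-set, choosing these H-sets would produce one along [oL a]. *)
  apply: contrapT => hn; apply: hD.
  have {}hn n : exists fY : nat * set nat, phi set0 a n fY.1 /\ Hset fY.1 fY.2.
    apply: contrapT => hc; apply: hn; exists n => m hm [X hX]; apply: hc.
    by exists (m, X).
  have [F hF] := choice hn.
  exists [set z | (F (nfst z)).2 (nsnd z)].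
  exact: (Hset_lim (f := fun n => (F n).1) (Y := fun n => (F n).2) (fun n => (hF n).1) (fun n => (hF n).2)).
- by exists 0%N; model_tac; move: H0; rewrite Hstar1 => /H.
- exists 0%N; model_tac; apply: or_pos; rewrite modelsE.
  by move: H0; rewrite Hstar1 => hp; move: H1; rewrite (Hstar_lim _ H hp).
- exists 0%N; model_tac; apply: or_posC; rewrite modelsE => hn; left; apply: hneg.
  by rewrite modelsE => hd; apply: hn; move: H0; rewrite Hstar1 => hp; apply/(Hstar_lim _ H hp).
- by exists 0%N; model_tac; have := phi_fun H H0; lia.
- by exists 0%N; apply: or_pos; rewrite modelsE; exists cZero.
- by exists 0%N; apply: or_pos; rewrite modelsE; exists cSucc.
- by exists 0%N; apply: or_pos; rewrite modelsE; exists cFst.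
- by exists 0%N; apply: or_pos; rewrite modelsE; exists cSnd.
- by exists 0%N; model_tac; apply: or_pos; rewrite modelsE; exists cOracle; split=> //; left.
- exists 0%N; apply: or_posC; rewrite modelsE => hn; apply: or_pos; rewrite modelsE.
  by exists cOracle; split=> //; right.
- exists 0%N; model_tac; apply: or_pos; rewrite modelsE.
  by apply/phi_pair; exists e, f.
- exists 0%N; model_tac; apply: or_pos; rewrite modelsE.
  by case/phi_pair: H => u [w [hu hw ->]]; rewrite npairE.
- exists 0%N; model_tac; apply: or_pos; rewrite modelsE.
  by case/phi_pair: H => u [w [hu hw ->]]; rewrite npairE.
- exists 0%N; model_tac; apply: or_pos; rewrite modelsE.
  by apply/phi_comp; exists e.
- case: (pselect (exists u, phi (Hstar a) c d u)) => [[w hw]|hn]; [exists w|exists 0%N]; model_tac.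
    by apply: or_pos; rewrite modelsE.
  by case: hn; case/phi_comp: H => u [hu _]; exists u.
- exists 0%N; model_tac; apply: or_pos; rewrite modelsE.
  by case/phi_comp: H => u [hu hw]; rewrite (phi_fun H0 hu).
- by exists 0%N; model_tac; apply: or_pos; rewrite modelsE; apply/phi_prec0.
- by exists 0%N; model_tac; apply: or_pos; rewrite modelsE; move/phi_prec0: H.
- exists 0%N; model_tac; apply: or_pos; rewrite modelsE; apply/phi_precS; by exists f.
- case: (pselect (exists u, phi (Hstar a) (nPrec b c) (npair d e) u)) => [[w hw]|hn]; [exists w|exists 0%N]; model_tac.
    by apply: or_pos; rewrite modelsE.
  by case: hn; case/phi_precS: H => u [hu _]; exists u.
- exists 0%N; model_tac; apply: or_pos; rewrite modelsE.
  by case/phi_precS: H => u [hu hw]; rewrite (phi_fun H0 hu).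
- by exists 0%N; model_tac; apply: or_pos; rewrite modelsE; case/phi_mu: H.
- case: (pselect (exists u, phi (Hstar a) b (npair c d) u.+1)) => [[w hw]|hn]; [exists w|exists 0%N]; model_tac.
    by apply: or_pos; rewrite modelsE.
  by case: hn; case/phi_mu: H => _; apply; rewrite ltnS leq_addr.
- by exists 0%N; apply: or_pos; rewrite modelsE.
- exists 0%N; model_tac; apply: or_pos; rewrite modelsE => k.
  by rewrite ltnS leq_eqVlt => /orP[/eqP ->|/H //]; exists e.
- exists 0%N; model_tac; apply: or_pos; rewrite modelsE; exact/phi_mu.
- have [w hw] := active_infinitely_often a b c; exists w.
  by apply: or_pos; rewrite modelsE.
- by exists 0%N; model_tac; left; exact: active_grid.
- by exists 0%N; rewrite nth_nil /=; apply: or_pos; rewrite modelsE; exists set0; exact: Hset_zero.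
Qed.

Lemma model_sat n : exists w, h (lit n w).
Proof.
set p := nsnd n.
have [w] := model_clauses (nfst n) (proj 0 p) (proj 1 p) (proj 2 p) (proj 3 p) (proj 4 p)
  (proj 5 p) (proj 6 p).
move=> /pick_intro [s hs]; exists (npair s w).
by rewrite /lit !npairE.
Qed.

End Model.

Transparent oS oL nPair nComp nPrec nMu neg pos grid vD vH vE vS vQ vY.

(** * Geometry of the literals *)

(** Decodes to a / (d + 1); balls with denominator D are therefore written with [D.-1]. *)
Definition ratc a d := npair (npair a 0) d.
Definition ballc a b r d := npair (npair (ratc a d) (ratc b d)) (ratc r d).

Definition rplus x := nfst (nfst x).
Definition rminus x := nsnd (nfst x).
Definition rden x := (nsnd x).+1.
Definition rabs x := ((rplus x - rminus x) + (rminus x - rplus x))%N.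

(* The vector coded by q has sup norm in [1/2, 2]. *)
Definition good q :=
  let x := nfst q in let y := nsnd q in
  [&& (rabs x <= 2 * rden x), (rabs y <= 2 * rden y) &
      (rden x <= 2 * rabs x) || (rden y <= 2 * rabs y)]%N.

(* |a rho_1 + b rho_2 - (z1 - z2) L / N| <= 8 with denominators cleared, where
   rho is the rational vector coded by q; see closeE. *)
Definition close j q a b z1 z2 :=
  let x := nfst q in let y := nsnd q in
  let k := (2 ^ (j * nexp j) * (rden x * rden y))%N in
  let u := (a * (rplus x * rden y) + b * (rplus y * rden x) + z2 * k)%N in
  let v := (a * (rminus x * rden y) + b * (rminus y * rden x) + z1 * k)%N in
  let c := (8 * (rden x * rden y))%N in
  (u <= v + c)%N && (v <= u + c)%N.

(* Bit i is 0 or 1 within 1/8 of z + 1/4 or z + 3/4, in units of 2^-mexp i.  A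
   stage condition is covered by balls of radius 2/L around points of the grid of
   mesh 1/L; it is void if q is not good.  The ball of radius 0 is empty. *)
Definition ballcode l y :=
  let kind := nfst l in let i := nsnd l in
  if (kind <= 1)%N then
    ballc (16 * nfst y + (4 + 8 * kind)) (nsnd y) 2 (16 * 2 ^ mexp i).-1
  else
    let j := nfst i in let q := nsnd i in
    let a := nfst (nfst y) in let b := nsnd (nfst y) in
    let z1 := nfst (nsnd y) in let z2 := nsnd (nsnd y) in
    if ~~ good q || close j q a b z1 z2 then ballc a b 2 (2 ^ kexp j).-1
    else ballc 0 0 0 0.

Lemma recursive_ballcode l y : recursive l -> recursive y ->
  recursive (fun x => ballcode (l x) (y x)).
Proof.
move=> hl hy; rewrite /ballcode.
have h1 : recursive (fun x => mexp (nsnd (l x))) by apply: recursive_mexp; rec_tac.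
have h2 : recursive (fun x => nexp (nfst (nsnd (l x)))) by apply: recursive_nexp; rec_tac.
have h3 : recursive (fun x => kexp (nfst (nsnd (l x)))) by apply: recursive_kexp; rec_tac.
by rewrite /ballc /ratc /good /close /rden /rabs /rplus /rminus; rec_tac.
Qed.

Local Open Scope ring_scope.

Section Geometry.
Context {R : realType}.
Implicit Types (p : R * R).

(** Written as the range of a recursive function of one coded triple, the form to which [ce_range]
    applies. *)
Definition index_set : set nat :=
  [set m | exists x, m = npair (nfst x) (ballcode (lit (nfst x) (nfst (nsnd x))) (nsnd (nsnd x)))].

Lemma index_setE n k : index_set (npair n k) <-> exists w y, k = ballcode (lit n w) y.
Proof.
split=> [[x /npair_inj [-> ->]]|[w [y ->]]].
  by exists (nfst (nsnd x)), (nsnd (nsnd x)).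
by exists (npair n (npair w y)); rewrite !npairE.
Qed.

Lemma ce_index_set : ce index_set.
Proof.
apply: ce_range; apply: recursive_pair; first by rec_tac.
apply: recursive_ballcode; last by rec_tac.
by apply: recursive_lit; rec_tac.
Qed.

Definition event p l := exists y, rational_ball (ballcode l y) p.

Definition witness_set : set (R * R) :=
  (\bigcap_(n in [set: nat]) \bigcup_(k in [set k | index_set (npair n k)]) rational_ball k)
  `&` unit_square.

Lemma lightface_witness_set : lightface_Pi02 witness_set.
Proof. by exists index_set; split=> //; exact: ce_index_set. Qed.

Lemma witness_setE p : witness_set p <->
  unit_square p /\ forall n, exists w, event p (lit n w).
Proof.
split=> [[hp sq]|[sq hp]]; split=> // n.
  by have [k /= /index_setE [w [y ->]] hk] := hp n I; exists w, y.
by move=> _; have [w [y hy]] := hp n; exists (ballcode (lit n w) y) => //=; apply/index_setE; exists w, y.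
Qed.

Lemma dist2_ge1 p q : `|p.1 - q.1| <= dist2 p q.
Proof.
rewrite -sqrtr_sqr /dist2; apply: ler_wsqrtr.
by rewrite lerDl sqr_ge0.
Qed.

Lemma dist2_ge2 p q : `|p.2 - q.2| <= dist2 p q.
Proof.
rewrite -sqrtr_sqr /dist2; apply: ler_wsqrtr.
by rewrite lerDr sqr_ge0.
Qed.

Lemma dist2_le p q : dist2 p q <= `|p.1 - q.1| + `|p.2 - q.2|.
Proof.
rewrite /dist2 -[leRHS]ger0_norm ?addr_ge0// -sqrtr_sqr; apply: ler_wsqrtr.
rewrite -[(p.1 - q.1) ^+ 2]real_normK ?num_real// -[(p.2 - q.2) ^+ 2]real_normK ?num_real//.
have := normr_ge0 (p.1 - q.1); have := normr_ge0 (p.2 - q.2).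
move: (`|_|) (`|_|) => x y hx hy; nra.
Qed.

Lemma ratcodeE x : ratcode x = ((rplus x)%:R - (rminus x)%:R) / (rden x)%:R :> R.
Proof. by []. Qed.

Lemma ratcode_ratc a d : ratcode (ratc a d) = a%:R / d.+1%:R :> R.
Proof. by rewrite /ratcode /ratc !npairE subr0. Qed.

Lemma ball_coord a b d p : (0 < d)%N -> rational_ball (ballc a b 2 d.-1) p ->
  `|p.1 - a%:R / d%:R| <= 2 / d%:R /\ `|p.2 - b%:R / d%:R| <= 2 / d%:R.
Proof.
move=> d0; rewrite /rational_ball /ballc /= !npairE !ratcode_ratc prednK // => h.
by split; apply: le_trans (ltW h); [exact: (dist2_ge1 p (_, _))|exact: (dist2_ge2 p (_, _))].
Qed.

Lemma coord_ball a b d p : (0 < d)%N ->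
  `|p.1 - a%:R / d%:R| < 1 / d%:R -> `|p.2 - b%:R / d%:R| < 1 / d%:R ->
  rational_ball (ballc a b 2 d.-1) p.
Proof.
move=> d0 h1 h2; rewrite /rational_ball /ballc /= !npairE !ratcode_ratc prednK //.
by apply: le_lt_trans (dist2_le _ _) _; rewrite (_ : 2 / _ = 1 / d%:R + 1 / d%:R) ?ltrD //; lra.
Qed.

(** In units of 1/(16 M) the strips for bit 0 are centred at 16 z + 4 and those for bit 1 at 16 z' +
    12, all with half-width 2. The centres are at least 8 apart. *)
Lemma event_neg_pos v p : event p (neg v) -> ~ event p (pos v).
Proof.
move=> [y hy] [y' hy']; move: hy hy'; rewrite /ballcode /neg /pos !npairE /=.
have D0 : (0 < 16 * 2 ^ mexp v)%N by rewrite muln_gt0 expn_gt0.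
move=> /(ball_coord D0) [+ _] /(ball_coord D0) [+ _].
set D := (16 * 2 ^ mexp v)%N in D0 *; have {D0} D0 : (0 : R) < D%:R by rewrite ltr0n.
move: (nfst y) (nfst y') => z z'.
have E (n : nat) : p.1 - n%:R / D%:R = (p.1 * D%:R - n%:R) / D%:R.
  by field; rewrite gt_eqF.
rewrite !E !normrM normfV (ger0_norm (ltW D0)) !ler_pM2r ?invr_gt0//.
rewrite !ler_norml => /andP[h1 h2] /andP[h3 h4].
move: h1 h2 h3 h4; rewrite muln0 muln1 addn0 (natrD R (16 * z)%N) (natrD R (16 * z')%N).
rewrite (natrD R 4 8) => h1 h2 h3 h4.
have g1 : ((16 * z' + 4)%:R : R) <= (16 * z)%:R by rewrite (natrD R (16 * z')%N); lra.
have g2 : ((16 * z)%:R : R) <= (16 * z' + 12)%:R by rewrite (natrD R (16 * z')%N); lra.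
by rewrite !ler_nat in g1 g2; lia.
Qed.

Lemma truncn_approx (x : R) (d : nat) : 0 <= x -> (0 < d)%N ->
  `|x - (Num.truncn (x * d%:R))%:R / d%:R| < 1 / d%:R.
Proof.
move=> x0 d0; have dR : (0 : R) < d%:R by rewrite ltr0n.
have /andP[] := truncn_itv (mulr_ge0 x0 (ltW dR)); rewrite -addn1 natrD.
set t := (Num.truncn _)%:R => h1 h2.
rewrite (_ : x - t / d%:R = (x * d%:R - t) / d%:R); last by field; rewrite gt_eqF.
by rewrite normrM normfV (gtr0_norm dR) ltr_pM2r ?invr_gt0// ltr_norml; apply/andP; split; lra.
Qed.

Lemma bit_event (b : bool) v (z : nat) p : 0 <= p.2 ->
  `|p.1 * 2 ^+ mexp v - (z%:R + 1 / 4 + b%:R / 2)| <= 1 / 32 -> event p (npair b v).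
Proof.
move=> p0 h; set D := (16 * 2 ^ mexp v)%N.
have D0 : (0 < D)%N by rewrite muln_gt0 expn_gt0.
exists (npair z (Num.truncn (p.2 * D%:R))).
rewrite /ballcode !npairE (_ : (b <= 1)%N = true); last by case: (b).
rewrite -/D; apply: coord_ball => //; last exact: truncn_approx.
have dR : (0 : R) < D%:R by rewrite ltr0n.
have DE : D%:R = 16 * 2 ^+ mexp v :> R by rewrite /D natrM natrX.
clearbody D; rewrite (_ : p.1 - _ / D%:R = 16 * (p.1 * 2 ^+ mexp v - (z%:R + 1 / 4 + b%:R / 2)) / D%:R).
  rewrite normrM normfV (gtr0_norm dR) ltr_pM2r ?invr_gt0// normrM ger0_norm//; lra.
rewrite (natrD R (16 * z)) (natrD R 4) !natrM DE; field; by rewrite expf_neq0.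
Qed.

Lemma norm_ratcode x : `|ratcode x : R| = (rabs x)%:R / (rden x)%:R.
Proof.
rewrite ratcodeE normrM normfV [`|(rden x)%:R|]ger0_norm ?ler0n//; congr (_ / _).
rewrite /rabs; case: (leqP (rplus x) (rminus x)) => h.
  rewrite (_ : (rplus x - rminus x)%N = 0%N) ?add0n ?natrB//; last by apply/eqP.
  by rewrite ler0_norm ?opprB// subr_le0 ler_nat.
rewrite (_ : (rminus x - rplus x)%N = 0%N) ?addn0 ?natrB ?(ltnW h)//; last exact/eqP/ltnW.
by rewrite ger0_norm// subr_ge0 ler_nat ltnW.
Qed.

Definition rho q : R * R := (ratcode (nfst q), ratcode (nsnd q)).

Lemma goodE q : good q <->
  [/\ `|(rho q).1| <= 2, `|(rho q).2| <= 2 & 1 / 2 <= `|(rho q).1| \/ 1 / 2 <= `|(rho q).2|].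
Proof.
rewrite /rho /good /= !norm_ratcode.
have H1 x : (`|ratcode x : R| <= 2) = (rabs x <= 2 * rden x)%N.
  by rewrite norm_ratcode ler_pdivrMr ?ltr0n// -natrM ler_nat.
have H2 x : (1 / 2 <= `|ratcode x : R|) = (rden x <= 2 * rabs x)%N.
  by rewrite norm_ratcode ler_pdivlMr ?ltr0n// mulrAC ler_pdivrMr// mul1r mulrC -natrM ler_nat.
rewrite -!norm_ratcode !H1 !H2; split=> [/and3P[-> -> /orP h]|[-> -> /orP]] //.
Qed.

Lemma closeE j q a b z1 z2 : close j q a b z1 z2 <->
  `|a%:R * (rho q).1 + b%:R * (rho q).2 - (z1%:R - z2%:R) * 2 ^+ (j * nexp j)| <= 8.
Proof.
rewrite /close /rho /= !ratcodeE.
set dx := rden (nfst q); set dy := rden (nsnd q); set K := (2 ^ (j * nexp j))%N.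
have dx0 : (0 : R) < dx%:R by rewrite ltr0n.
have dy0 : (0 : R) < dy%:R by rewrite ltr0n.
have d0 := mulr_gt0 dx0 dy0.
have -> : (2 : R) ^+ (j * nexp j) = K%:R by rewrite natrX.
rewrite -(ler_pM2r d0) -[X in _ * X <= _](gtr0_norm d0) -normrM ler_norml.
rewrite -!(ler_nat R) !(natrD, natrM).
set u := rplus (nfst q); set u' := rplus (nsnd q).
set w := rminus (nfst q); set w' := rminus (nsnd q).
rewrite (_ : (_ - _) * _ = a%:R * (u%:R * dy%:R) + b%:R * (u'%:R * dx%:R) + z2%:R * (K%:R * (dx%:R * dy%:R)) -
  (a%:R * (w%:R * dy%:R) + b%:R * (w'%:R * dx%:R) + z1%:R * (K%:R * (dx%:R * dy%:R)))); last first.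
  by field; rewrite !gt_eqF.
by split=> /andP[h1 h2]; apply/andP; split; lra.
Qed.

Lemma expL j : (2 : R) ^+ kexp j = 2 ^+ (j * nexp j) * 2 ^+ nexp j.
Proof. by rewrite /kexp mulSn addnC exprD. Qed.

Lemma gridE j q : grid j q = npair 2 (npair j q).
Proof. by []. Qed.

Lemma grid_event_close j q p : good q -> event p (grid j q) ->
  exists z : int, `|p.1 * (rho q).1 + p.2 * (rho q).2 - z%:~R / 2 ^+ nexp j| <= 16 / 2 ^+ kexp j.
Proof.
move=> gq [y]; rewrite /ballcode gridE !npairE gq /=.
set a := nfst (nfst y); set b := nsnd (nfst y); set z1 := nfst (nsnd y); set z2 := nsnd (nsnd y).
case: ifPn => [/closeE hc|_]; last first.
  rewrite /rational_ball /= /ballc !npairE !ratcode_ratc mul0r => /(le_lt_trans (dist2_ge1 _ _)).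
  by rewrite ltNge normr_ge0.
have L0 : (0 < 2 ^ kexp j)%N by rewrite expn_gt0.
move=> /(ball_coord L0); rewrite natrX; set L := 2 ^+ kexp j.
have {}L0 : 0 < L by rewrite exprn_gt0.
move=> [h1 h2].
have /goodE [r1 r2 _] := gq.
exists (z1%:Z - z2%:Z); move: hc; rewrite intrD intrN -!pmulrn => hc.
have N0 : (0 : R) < 2 ^+ nexp j by rewrite exprn_gt0.
have K0 : (0 : R) < 2 ^+ (j * nexp j) by rewrite exprn_gt0.
set x := (rho q).1 in r1 hc *; set x' := (rho q).2 in r2 hc *.
rewrite -[ratcode (nfst q)]/x -[ratcode (nsnd q)]/x'.
rewrite (_ : _ - _ = (p.1 - a%:R / L) * x + (p.2 - b%:R / L) * x' +
   (a%:R * x + b%:R * x' - (z1%:R - z2%:R) * 2 ^+ (j * nexp j)) / L); last first.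
  by rewrite /L expL; field; rewrite !gt_eqF.
(* Each coordinate is off by at most 2/L and weighted by at most 2; [close] adds 8/L. *)
apply: (@le_trans _ _ (2 / L * 2 + 2 / L * 2 + 8 / L)); last by rewrite -!mulrA; lra.
apply: le_trans (ler_normD _ _) _; apply: lerD; last first.
  by rewrite normrM normfV (gtr0_norm L0) ler_pM2r ?invr_gt0.
apply: le_trans (ler_normD _ _) _; apply: lerD.
  by rewrite normrM; apply: ler_pM.
by rewrite normrM; apply: ler_pM.
Qed.

(** Programs that compute no direction must not make the formula unsatisfiable. *)
Lemma grid_event_bad j q p : unit_square p -> ~~ good q -> event p (grid j q).
Proof.
move=> [/andP[p1 _] /andP[p2 _]] gq.
have L0 : (0 < 2 ^ kexp j)%N by rewrite expn_gt0.
exists (npair (npair (Num.truncn (p.1 * (2 ^ kexp j)%:R)) (Num.truncn (p.2 * (2 ^ kexp j)%:R))) 0).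
rewrite /ballcode gridE !npairE gq /=.
by apply: coord_ball => //; exact: truncn_approx.
Qed.

Lemma grid_event_good j q p (z : int) : unit_square p -> good q ->
  `|p.1 * (rho q).1 + p.2 * (rho q).2 - z%:~R / 2 ^+ nexp j| <= 4 / 2 ^+ kexp j ->
  event p (grid j q).
Proof.
move=> [/andP[p1 _] /andP[p2 _]] gq hz.
have L0 : (0 < 2 ^ kexp j)%N by rewrite expn_gt0.
have h1 := truncn_approx p1 L0; have h2 := truncn_approx p2 L0.
set a := Num.truncn _ in h1; set b := Num.truncn _ in h2.
have [z1 [z2 zE]] : exists z1 z2 : nat, z = z1%:Z - z2%:Z.
  by case: z {hz} => n; [exists n, 0%N|exists 0%N, n.+1]; rewrite ?subr0 ?sub0r ?NegzE.
exists (npair (npair a b) (npair z1 z2)).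
rewrite /ballcode gridE !npairE gq /= (_ : close _ _ _ _ _ _ = true).
  exact: coord_ball.
apply/closeE.
move: hz h1 h2; rewrite zE intrD intrN -!pmulrn natrX; set L := 2 ^+ kexp j => hz h1 h2.
have {}L0 : 0 < L by rewrite exprn_gt0.
have /goodE [r1 r2 _] := gq.
have N0 : (0 : R) < 2 ^+ nexp j by rewrite exprn_gt0.
have K0 : (0 : R) < 2 ^+ (j * nexp j) by rewrite exprn_gt0.
set x := (rho q).1 in r1 hz *; set x' := (rho q).2 in r2 hz *.
rewrite -(ler_pM2r (_ : 0 < L^-1)) ?invr_gt0// -{1}(gtr0_norm (_ : 0 < L^-1)) ?invr_gt0// -normrM.
rewrite (_ : (_ - _) / L = (p.1 * x + p.2 * x' - (z1%:R - z2%:R) / 2 ^+ nexp j) -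
   (p.1 - a%:R / L) * x - (p.2 - b%:R / L) * x'); last first.
  by rewrite /L expL; field; rewrite !gt_eqF.
(* Rounding each coordinate to the 1/L grid costs 2/L, which together with the assumed 4/L exhausts
   the 8/L allowed by [close]. *)
apply: (@le_trans _ _ (4 / L + 1 / L * 2 + 1 / L * 2)); last by rewrite -!mulrA; lra.
apply: le_trans (ler_normB _ _) _; apply: lerD; last first.
  by rewrite normrM; apply: ler_pM => //; exact: ltW.
apply: le_trans (ler_normB _ _) _; apply: lerD => //.
by rewrite normrM; apply: ler_pM => //; exact: ltW.
Qed.

End Geometry.

(** * A point on every line of suitable slope *)

Lemma mexp0 : mexp 0 = 2%N. Proof. by []. Qed.

Lemma mexpS j : (2 * j.+2 * mexp j <= mexp j.+1)%N.
Proof.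
rewrite /mexp (_ : j.+2 * j.+2 = (2 * j.+1).+1 + j.+1 * j.+1)%N; last by lia.
rewrite expnD leq_mul2r expnS; apply/orP; right.
by rewrite leq_mul2l /=; apply: leq_trans (ltn_expl (2 * j.+1) (isT : 1 < 2)%N); lia.
Qed.

Lemma mexp_gt1 j : (1 < mexp j)%N.
Proof. by rewrite /mexp -[ltnLHS](expn0 2) ltn_exp2l. Qed.

Lemma mexp_ge j : (j < mexp j)%N.
Proof. by rewrite /mexp; apply: leq_trans (ltn_expl _ (isT : 1 < 2)%N); rewrite mulSn; lia. Qed.

Lemma mexpS6 j : (mexp j + 6 <= mexp j.+1)%N.
Proof. by have := mexpS j; have := mexp_gt1 j; nia. Qed.

(** The radius 1/M left for stage j + 1 is at most 1/L of stage j, so later moves do not spoil the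
    grid condition already arranged. *)
Lemma kexp_le j : (kexp j <= mexp j.+1)%N.
Proof. by have := mexpS j; rewrite /kexp /nexp; nia. Qed.

Section Construction.
Context {R : realType}.

(** The intervals with centre [v j] and radius [r j] are nested; the supremum of their left ends
    lies in all of them. *)
Lemma nested_limit (v r : nat -> R) : (forall j, 0 <= r j) ->
  (forall j, `|v j.+1 - v j| <= r j - r j.+1) -> exists u, forall j, `|u - v j| <= r j.
Proof.
move=> r0 h.
have hd i j : (i <= j)%N -> `|v j - v i| <= r i - r j.
  move=> /subnKC <-; elim: (j - i)%N => [|k IH]; first by rewrite addn0 !subrr normr0.
  rewrite addnS; have := ler_normD (v (i + k).+1 - v (i + k)%N) (v (i + k)%N - v i).
  rewrite addrA subrK; have := h (i + k)%N; lra.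
pose A := [set x | exists j, x = v j - r j].
have Aub j : ubound A (v j + r j).
  move=> _ [i ->]; have := r0 i; have := r0 j.
  case/orP: (leq_total i j) => /hd; rewrite ler_norml => /andP[]; lra.
have A0 : A !=set0 by exists (v 0%N - r 0%N), 0%N.
exists (sup A) => j; rewrite ler_distl; apply/andP; split.
  by apply: ub_le_sup; [exists (v 0%N + r 0%N)|exists j].
exact: ge_sup.
Qed.

Variables (lam t : R) (bit : nat -> bool) (active : nat -> Prop) (val : nat -> nat -> Prop).
Hypothesis lam0 : 0 <= lam <= 1 / 2.
Hypothesis t0 : 0 <= t <= 1 / 2.
Hypothesis val_fun : forall j q q', val j q -> val j q' -> q = q'.
Hypothesis active_slope : forall j q, active j -> val j q -> good q ->
  64 / 2 ^+ mexp j <= `|(rho q).1 + lam * (rho q).2|.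

(** In units of 1/M, a move of at most 3/4 reaches the centre [tau] of a strip for bit j, a further
    1/64 puts the projection exactly on the grid, and the new radius is at most 1/64. The lower
    bound on v keeps the interval nonnegative, so the strip number is a natural number. *)
Lemma stage j v : (2 ^+ mexp j)^-1 <= v -> exists v',
  `|v' - v| <= (2 ^+ mexp j)^-1 - (2 ^+ mexp j.+1)^-1 /\
  forall u, `|u - v'| <= (2 ^+ mexp j.+1)^-1 ->
    (exists z : nat, `|u * 2 ^+ mexp j - (z%:R + 1 / 4 + (bit j)%:R / 2)| <= 1 / 32) /\
    forall q, active j -> val j q -> good q -> exists z : int,
      `|u * (rho q).1 + (t + lam * u) * (rho q).2 - z%:~R / 2 ^+ nexp j| <= 4 / 2 ^+ kexp j.
Proof.
set M : R := 2 ^+ mexp j; set M' : R := 2 ^+ mexp j.+1 => vM.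
have M0 : 0 < M by rewrite exprn_gt0.
have M'0 : 0 < M' by rewrite exprn_gt0.
have MM' : M'^-1 <= M^-1 / 64.
  rewrite -invfM lef_pV2 ?posrE ?mulr_gt0// (_ : 64 = 2 ^+ 6); last by rewrite -natrX.
  by rewrite -exprD ler_eXn2l ?ltr1n//; exact: mexpS6.
have iM0 : 0 < M^-1 by rewrite invr_gt0.
set z := Num.truncn (v * M); set b : R := (bit j)%:R.
have bE : 0 <= b <= 1 by rewrite /b; case: (bit j); rewrite ?lexx ?ler01.
have /truncn_itv : 0 <= v * M by rewrite mulr_ge0 ?(ltW M0)//; apply: le_trans vM; exact: ltW.
rewrite -/z -addn1 natrD => /andP[hz1 hz2].
set tau := (z%:R + 1 / 4 + b / 2) / M.
have tauM : tau * M = z%:R + 1 / 4 + b / 2 by rewrite mulfVK ?gt_eqF.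
have tv : `|tau - v| <= 3 / 4 * M^-1.
  rewrite (_ : tau - v = (tau * M - v * M) * M^-1); last by field; rewrite gt_eqF.
  rewrite normrM (gtr0_norm iM0) ler_pM2r// tauM ler_norml; apply/andP; split; lra.
have [v' vt hv'] : exists2 v', `|v' - tau| <= M^-1 / 64 & forall q, active j -> val j q -> good q ->
    exists z : int, v' * ((rho q).1 + lam * (rho q).2) + t * (rho q).2 = z%:~R / 2 ^+ nexp j.
  case: (pselect (exists q, [/\ active j, val j q & good q])) => [[q [aj vq gq]]|hn]; last first.
    exists tau; first by rewrite subrr normr0; lra.
    by move=> q h1 h2 h3; case: hn; exists q.
  have be := active_slope aj vq gq; set be_ := _ + _ in be.
  have be0 : 0 < `|be_| by apply: lt_le_trans be; rewrite divr_gt0.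
  have N0 : (0 : R) < 2 ^+ nexp j by rewrite exprn_gt0.
  have NE : (2 : R) ^+ nexp j = M * M by rewrite /nexp mul2n -addnn exprD.
  set y := tau * be_ + t * (rho q).2; set k := Num.floor (y * 2 ^+ nexp j).
  (* The grid has mesh 1/N = 1/M^2 and the projection moves with speed at least 64/M, so a grid
     value is met within 1/(64 M). *)
  exists (tau + (k%:~R / 2 ^+ nexp j - y) / be_).
    rewrite addrC addKr normrM normfV.
    apply: (@le_trans _ _ ((2 ^+ nexp j)^-1 / (64 / M))); last first.
      by rewrite NE; rewrite le_eqVlt; apply/orP; left; apply/eqP; field; rewrite !gt_eqF.
    apply: ler_pM; rewrite ?invr_ge0//; last first.
      by rewrite lef_pV2 ?posrE ?divr_gt0.
    have /andP[k1 k2] := floor_itv (y * 2 ^+ nexp j); rewrite -/k intrD in k1 k2.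
    rewrite (_ : _ - y = (k%:~R - y * 2 ^+ nexp j) / 2 ^+ nexp j); last by field; rewrite gt_eqF.
    rewrite normrM normfV (gtr0_norm N0) ler_piMl ?invr_ge0 ?(ltW N0)// ler_norml.
    by apply/andP; split; lra.
  move=> q' _ vq' _; rewrite -(val_fun vq vq'); exists k.
  by rewrite -/be_ mulrDl mulfVK -?normr_gt0// /y; lra.
exists v'; split.
  have := ler_normD (v' - tau) (tau - v); rewrite addrA subrK; lra.
move=> u uv; have ut : `|u - tau| <= M^-1 / 32.
  have := ler_normD (u - v') (v' - tau); rewrite addrA subrK; lra.
split.
  exists z; rewrite -tauM -mulrBl normrM (gtr0_norm M0) -ler_pdivlMr//; lra.
move=> q aj vq gq; have [k hk] := hv' q aj vq gq; exists k.
have /(@goodE R) [r1 r2 _] := gq.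
rewrite (_ : _ - _ = (u - v') * ((rho q).1 + lam * (rho q).2)); last by rewrite -hk; ring.
(* The speed is at most 2 + 2/2 = 3, and u is within 1/L of [v'] by [kexp_le]. *)
rewrite normrM mulrC; apply: ler_pM => //.
  apply: le_trans (ler_normD _ _) _; have /andP[l1 l2] := lam0.
  rewrite [`|lam * _|]normrM (ger0_norm l1); have := normr_ge0 (rho q).2; nra.
apply: le_trans uv _; rewrite lef_pV2 ?posrE ?exprn_gt0// ler_eXn2l ?ltr1n//; exact: kexp_le.
Qed.

Lemma exists_point : exists u, let p := (u, t + lam * u) in
  [/\ unit_square p, forall j, event p (npair (bit j) j) &
      forall j q, active j -> val j q -> event p (grid j q)].
Proof.
pose r j : R := (2 ^+ mexp j)^-1.
have r0 j : 0 < r j by rewrite invr_gt0 exprn_gt0.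
have r1 : r 0%N = 1 / 4 by rewrite /r mexp0 -natrX div1r.
have step (jv : nat * R) : exists v', r jv.1 <= jv.2 -> 
  `|v' - jv.2| <= r jv.1 - r jv.1.+1 /\
  forall u, `|u - v'| <= r jv.1.+1 ->
    (exists z : nat, `|u * 2 ^+ mexp jv.1 - (z%:R + 1 / 4 + (bit jv.1)%:R / 2)| <= 1 / 32) /\
    forall q, active jv.1 -> val jv.1 q -> good q -> exists z : int,
      `|u * (rho q).1 + (t + lam * u) * (rho q).2 - z%:~R / 2 ^+ nexp jv.1| <= 4 / 2 ^+ kexp jv.1.
  case: (pselect (r jv.1 <= jv.2)) => [/stage [v' hv']|]; [by exists v'|by exists 0].
have [g hg] := choice step.
(* The initial interval is [1/4, 3/4], which keeps t + lam u between 0 and 1. *)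
pose v := fix v j := if j is i.+1 then g (i, v i) else 1 / 2.
have v0 j : r j <= v j.
  elim: j => [|j vj]; first by rewrite r1 /v; lra.
  have [] := hg (j, v j) vj; rewrite /= -[g _]/(v j.+1) ler_norml => /andP[]; lra.
have [u hu] := @nested_limit v r (fun j => ltW (r0 j)) (fun j => (hg (j, v j) (v0 j)).1).
exists u => p.
have usq : 1 / 4 <= u <= 3 / 4.
  have := hu 0%N; rewrite r1 -[v 0%N]/(1 / 2) ler_norml => /andP[h1 h2].
  by apply/andP; split; lra.
have psq : unit_square p.
  rewrite /p; split => /=; first by lra.
  have /andP[l1 l2] := lam0; have /andP[t1 t2] := t0; have /andP[u1 u2] := usq.
  apply/andP; split; nra.
have hh j := (hg (j, v j) (v0 j)).2 u (hu j.+1).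
split=> // [j|j q aj vq].
  have [[z hz] _] := hh j; have [_ /andP[p2 _]] := psq.
  exact: (@bit_event _ (bit j) j z p p2 hz).
have [gq|gq] := boolP (good q); last exact: grid_event_bad.
have [_ /(_ q aj vq gq) [z hz]] := hh j; exact: (@grid_event_good _ j q p z psq gq hz).
Qed.

End Construction.

(** * Hausdorff measure *)

Lemma exp2V_lt {R : realType} (x : R) : 0 < x -> exists m : nat, 2 ^- m <= x.
Proof.
move=> x0; exists (Num.truncn x^-1).+1.
have /andP[_ h] := truncn_itv (ltW (eqbRL (invr_gt0 x) x0)).
rewrite -[leRHS]invrK lef_pV2 ?posrE ?exprn_gt0 ?invr_gt0//.
by apply: le_trans (ltW h) _; rewrite -natrX ler_nat ltnW// ltn_expl.
Qed.

Section HausdorffMeasure.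
Context {R : realType} {T : Type} (d : T -> T -> R).
Hypothesis d_ge0 : forall x y, 0 <= d x y.
Local Open Scope ereal_scope.

Lemma hcost_ge0 s U : 0 <= hcost d s U.
Proof. by rewrite /hcost; case: ifP => // _; exact: poweR_ge0. Qed.

Lemma diam_ge0 (U : set T) : U !=set0 -> 0 <= diam d U.
Proof.
move=> [x Ux]; apply: (@le_trans _ _ (d x x)%:E); first by rewrite lee_fin.
by apply: ereal_sup_ubound; exists x => //; exists x.
Qed.

Lemma diam0 : diam d set0 = -oo.
Proof.
rewrite /diam [X in ereal_sup X](_ : _ = set0) ?ereal_sup0//.
by apply/seteqP; split=> x //= [y []].
Qed.

Lemma diam_le (U : set T) (r : R) : (forall x y, U x -> U y -> (d x y <= r)%R) ->
  diam d U <= r%:E.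
Proof. by move=> h; apply: ge_ereal_sup => _ [x Ux [y Uy <-]]; rewrite lee_fin; exact: h. Qed.

Lemma hcost_le s (U : set T) (r : R) : (0 <= s)%R -> (0 <= r)%R -> diam d U <= r%:E ->
  hcost d s U <= (r `^ s)%:E.
Proof.
move=> s0 r0 h; rewrite /hcost; case: ifPn => [_|/set0P U0]; first by rewrite lee_fin powR_ge0.
rewrite -poweR_EFin; apply: gt0_ler_poweR => //; rewrite in_itv/= leey ?andbT ?lee_fin//.
exact: diam_ge0.
Qed.

Lemma hausdorff_measure_eq0 s A :
  (forall delta eta : R, (0 < delta)%R -> (0 < eta)%R -> exists U : nat -> set T,
    [/\ A `<=` \bigcup_i U i, forall i, diam d (U i) <= delta%:E &
      \sum_(0 <= i <oo) hcost d s (U i) <= eta%:E]) ->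
  hausdorff_measure d s A = 0.
Proof.
move=> h; apply/eqP; rewrite eq_le; apply/andP; split.
  apply: ge_ereal_sup => _ [delta /= d0 <-]; apply/lee_addgt0Pr => eta eta0.
  rewrite add0e; have [U [AU dU sU]] := h delta eta d0 eta0.
  by apply: le_trans sU; apply: ereal_inf_lbound; exists U.
apply: (@le_trans _ _ (hausdorff_premeasure d s 1 A)); last first.
  by apply: ereal_sup_ubound; exists 1%R => //=.
apply: le_ereal_inf_tmp => _ [U _ <-]; apply: nneseries_ge0 => i _ _; exact: hcost_ge0.
Qed.

Lemma nneseries_npair (f : nat -> nat -> \bar R) : (forall i j, 0 <= f i j) ->
  \sum_(0 <= n <oo) f (nfst n) (nsnd n) = \sum_(0 <= i <oo) \sum_(0 <= j <oo) f i j.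
Proof.
move=> f0; rewrite nneseries_esumT// nneseries_esumT; last by move=> i; exact: nneseries_ge0.
rewrite -(@reindex_esum R nat (nat * nat)%type setT setT (fun n => (nfst n, nsnd n)) (fun k => f k.1 k.2)); last first.
  split=> //; first by move=> x y _ _ [h1 h2]; rewrite -(npair_proj x) -(npair_proj y) h1 h2.
  by move=> [i j] _; exists (npair i j) => //; rewrite !npairE.
under [RHS]eq_esum do rewrite nneseries_esumT//.
by rewrite esum_esum//; congr (esum _ _); apply/seteqP; split.
Qed.

Lemma nneseries_le (u : nat -> \bar R) x : (forall i, 0 <= u i) ->
  (forall n, \sum_(0 <= i < n) u i <= x) -> \sum_(0 <= i <oo) u i <= x.
Proof.
by move=> u0 h; apply: lime_le; [apply: is_cvg_nneseries => i _ _; exact: u0|exact: nearW].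
Qed.

Lemma finite_support_sum_le (u : nat -> \bar R) (N : nat) (c : R) : (0 <= c)%R ->
  (forall i, u i <= (if (i < N)%N then c else 0)%:E) ->
  forall n, \sum_(0 <= i < n) u i <= (N%:R * c)%:E.
Proof.
move=> c0 h n; apply: (@le_trans _ _ ((minn n N)%:R * c)%:E); last first.
  by rewrite lee_fin ler_wpM2r// ler_nat geq_minr.
elim: n => [|n IH]; first by rewrite big_nil min0n mul0r.
rewrite big_nat_recr//=; apply: le_trans (leeD IH (h n)) _.
rewrite -EFinD lee_fin; case: (boolP (n < N)%N) => [|/[!(=^~ leqNgt)]] nN.
  by rewrite (minn_idPl (ltnW nN)) (minn_idPl nN) -natr1 mulrDl mul1r.
by rewrite (minn_idPr nN) (minn_idPr (leqW nN)) addr0.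
Qed.

(** Every point lies in pieces of arbitrarily late stages, so each tail of the stages covers [A];
    the costs of the stages in a tail are bounded by a geometric series with sum 2^-m. *)
Lemma limsup_hausdorff_measure0 s (N : nat -> nat) (r : nat -> R) (F : nat -> nat -> set T) A :
  (0 <= s)%R -> (forall j, 0 <= r j)%R ->
  (forall j i, (i < N j)%N -> diam d (F j i) <= (r j)%:E) ->
  (forall m : nat, exists k, forall j, (k <= j)%N ->
     (r j <= 2 ^- m)%R /\ ((N j)%:R * r j `^ s <= 2 ^- (m + j.+1))%R) ->
  (forall x, A x -> forall k, exists j i, [/\ (k <= j)%N, (i < N j)%N & F j i x]) ->
  hausdorff_measure d s A = 0.
Proof.
move=> s0 r0 hd hr hA; apply: hausdorff_measure_eq0 => delta eta d0 e0.
have mn0 : (0 < Num.min delta eta)%R by rewrite lt_min d0.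
have [m hm] := exp2V_lt mn0; have [k hk] := hr m.
move: hm; rewrite le_min => /andP[md me].
pose G j i := if (i < N (k + j))%N then F (k + j)%N i else set0.
have hG j i : hcost d s (G j i) <= (if (i < N (k + j))%N then r (k + j)%N `^ s else 0)%:E.
  rewrite /G; case: ifPn => [iN|_]; first exact/hcost_le/hd.
  by rewrite /hcost eqxx.
exists (fun n => G (nfst n) (nsnd n)); split.
- move=> x /hA /(_ k) [j [i [kj iN Fx]]]; exists (npair (j - k) i) => //.
  by rewrite /G !npairE subnKC // iN.
- move=> n; rewrite /G; case: ifPn => [iN|_]; last by rewrite diam0 leNye.
  apply: le_trans (hd _ _ iN) _; rewrite lee_fin.
  by apply: le_trans md; exact: (hk _ (leq_addr _ _)).1.
rewrite (nneseries_npair (f := fun i j => hcost d s (G i j))); last by move=> *; exact: hcost_ge0.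
apply: (@le_trans _ _ (\sum_(0 <= i <oo) ((2 ^- m) / (2 ^ i.+1)%:R)%:E)); last first.
  by apply: le_trans (epsilon_trick0 _ _) _; rewrite ?lee_fin// invr_ge0 exprn_ge0.
apply: lee_nneseries => [i _ _|j _]; first by apply: nneseries_ge0 => *; exact: hcost_ge0.
apply: nneseries_le => [i|n]; first exact: hcost_ge0.
apply: le_trans (@finite_support_sum_le _ (N (k + j)%N) _ (powR_ge0 _ _) (hG j) n) _.
rewrite lee_fin; apply: le_trans (hk _ (leq_addr _ _)).2 _.
rewrite natrX -invfM -exprD lef_pV2 ?posrE ?exprn_gt0// ler_eXn2l ?ltr1n//; lia.
Qed.

End HausdorffMeasure.

(** * Decay of the costs of the covers *)

Section Rates.
Context {R : realType}.

(** A power of 2 bounding the diameters of both covers below: at most 34/L on the line and 36/L in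
    the plane. *)
Definition mesh j : R := 64 / 2 ^+ kexp j.

Lemma mesh_ge0 j : 0 <= mesh j.
Proof. by rewrite divr_ge0// exprn_ge0. Qed.

Lemma meshE j : mesh j = 2 `^ (6 - (kexp j)%:R).
Proof.
rewrite powRD ?pnatr_eq0 ?implybT// powRN !powR_mulrn// /mesh; congr (_ / _).
by rewrite -natrX.
Qed.

Lemma nexp_gt j : (j < nexp j)%N.
Proof. by have := mexp_ge j; rewrite /nexp; lia. Qed.

(** About N L^h pieces of size about 1/L. Since L = N^(j+1), the gain L^(s-h) eventually beats the
    factor N; h is 0 for the projections and 1 for the plane. *)
Lemma mesh_rate (h : nat) (s : R) (m : nat) : h%:R < s -> exists k, forall j, (k <= j)%N ->
  mesh j <= 2 ^- m /\
  (2 ^ (nexp j + 4 + h * kexp j))%:R * mesh j `^ s <= 2 ^- (m + j.+1).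
Proof.
move=> hs; have s0 : 0 <= s by apply: le_trans (ltW hs); rewrite ler0n.
have c0 : 0 < s - h%:R by rewrite subr_gt0.
(* With n = [nexp j] at least j + 1, the product B n exceeds n + 4 + 6 s + m + j + 1, all that the
   gain in the exponent has to absorb. *)
set B := 8 + 6 * s + m%:R.
have B0 : 0 <= B by rewrite /B !addr_ge0// mulr_ge0.
exists (maxn (m + 6) (Num.truncn (B / (s - h%:R)))) => j; rewrite geq_max => /andP[j1 j2].
have jn := nexp_gt j.
have nk : (nexp j <= kexp j)%N by rewrite /kexp leq_pmull.
split.
  rewrite /mesh ler_pdivrMr ?exprn_gt0// ler_pdivlMl ?exprn_gt0// (_ : 64 = 2 ^+ 6); last by rewrite -natrX.
  rewrite -exprD ler_eXn2l ?ltr1n//; lia.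
have hB : B <= (s - h%:R) * j.+1%:R.
  rewrite mulrC -ler_pdivrMr//; have /andP[_ h1] := truncn_itv (divr_ge0 B0 (ltW c0)).
  by apply: le_trans (ltW h1) _; rewrite ler_nat.
have two0 : 0 <= 2 :> R by [].
rewrite meshE -powRrM natrX -!powR_mulrn// -powRN -powRD ?pnatr_eq0 ?implybT//.
apply: ler_powR; first by rewrite ler1n.
rewrite (natrD R (nexp j + 4)) (natrD R (nexp j)) (natrM R h) (natrD R m); have kE : (kexp j)%:R = j.+1%:R * (nexp j)%:R :> R by rewrite -natrM.
have n1 : j.+1%:R <= (nexp j)%:R :> R by rewrite ler_nat.
have := ler_wpM2r (ler0n R (nexp j)) hB; rewrite -mulrA -kE /B.
have n2 : 1 <= (nexp j)%:R :> R by rewrite (ler_nat _ 1); lia.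
have m0 : (0 : R) <= m%:R by [].
move: n1 n2; rewrite -[j.+1]addn1 (natrD R j); move: ((nexp j)%:R) ((kexp j)%:R) => n k n1 n2 hh.
have : 0 <= (n - 1) * (6 + 6 * s + m%:R) by rewrite mulr_ge0 ?subr_ge0// !addr_ge0// mulr_ge0.
lra.
Qed.

End Rates.

Section Projections.
Context {R : realType}.

(** * Projections of the witness set *)

Lemma kexp_ge4 j : (4 <= kexp j)%N.
Proof. by have := mexp_gt1 j; rewrite /kexp /nexp; nia. Qed.

Lemma liouville_projection (e p : R * R) : hyperarithmetic_direction e -> witness_set p ->
  forall k, exists j, (k <= j)%N /\ exists z : int,
    `|p.1 * e.1 + p.2 * e.2 - z%:~R / 2 ^+ nexp j| <= 17 / 2 ^+ kexp j.
Proof.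
move=> [edir [X [[a [H [_ hH XH]]] [f1 [/(computable_fun_turing_le XH) [c1 hc1] hf1]]
  [f2 [/(computable_fun_turing_le XH) [c2 hc2] hf2]]]]] /witness_setE [psq psat] k.
have hc n : oeval H (cPair c1 c2) n (npair (f1 n) (f2 n)) by exists (f1 n), (f2 n).
have [j kj hj] := @grid_infinitely_often (event p) (fun v => @event_neg_pos R v p) psat _ _ _ _ hH hc k.
exists j; split=> //; set r := rprec j in hj.
have rE : 2 ^- r = (2 ^+ kexp j)^-1 / 2 :> R by rewrite /r /rprec exprS invfM mulrC.
have L16 : (2 ^+ kexp j)^-1 <= 1 / 16 :> R.
  rewrite div1r lef_pV2 ?posrE ?exprn_gt0// (_ : 16 = 2 ^+ 4); last by rewrite -natrX.
  by rewrite ler_eXn2l ?ltr1n// kexp_ge4.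
have := hf1 r; have := hf2 r; rewrite rE => h2 h1.
rewrite {}/r in rE h1 h2 hj *; set r := rprec j in rE h1 h2 hj *; set q := npair (f1 r) (f2 r) in hj.
have q1 : (rho q).1 = ratcode (f1 r) :> R by rewrite /rho /q !npairE.
have q2 : (rho q).2 = ratcode (f2 r) :> R by rewrite /rho /q !npairE.
set i := (2 ^+ kexp j)^-1 in rE L16 h1 h2 *.
have i0 : 0 < i by rewrite invr_gt0 exprn_gt0.
have [x1 x2] := (sqr_ge0 e.1, sqr_ge0 e.2).
have e1 : -1 <= e.1 <= 1 by move: edir; rewrite /direction => ?; apply/andP; split; nra.
have e2 : -1 <= e.2 <= 1 by move: edir; rewrite /direction => ?; apply/andP; split; nra.
have gq : good q.
  (* The approximation error is at most 1/32. If both approximations were below 1/2, both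
     coordinates of the unit vector would be below 5/8, and 2 (5/8)^2 < 1. *)
  apply/(@goodE R); rewrite q1 q2; move: h1 h2; rewrite !ler_norml => h1 h2; split; [lra|lra|].
  case: (lerP (1 / 2) `|ratcode (f1 r) : R|) => [|k1]; first by left.
  case: (lerP (1 / 2) `|ratcode (f2 r) : R|) => [|k2]; first by right.
  exfalso; move: k1 k2; rewrite !ltr_norml => /andP[k1 k1'] /andP[k2 k2'].
  move: h1 h2 => /andP[h1 h1'] /andP[h2 h2'].
  have : e.1 ^+ 2 <= (5 / 8) ^+ 2 by rewrite !expr2; nra.
  have : e.2 ^+ 2 <= (5 / 8) ^+ 2 by rewrite !expr2; nra.
  by move: edir; rewrite /direction; lra.
have [z] := grid_event_close gq hj; rewrite q1 q2 => hz; exists z.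
rewrite (_ : _ - _ = (p.1 * ratcode (f1 r) + p.2 * ratcode (f2 r) - z%:~R / 2 ^+ nexp j)
   + p.1 * (e.1 - ratcode (f1 r)) + p.2 * (e.2 - ratcode (f2 r))); last by ring.
have [/andP[a1 a2] /andP[b1 b2]] := psq.
(* Precision [rprec j] costs 1/(2 L) per coordinate when the approximate direction is replaced by
   the true one. *)
apply: (@le_trans _ _ (16 * i + 1 * (i / 2) + 1 * (i / 2))); last by rewrite /i; lra.
apply: le_trans (ler_normD _ _) _; apply: lerD.
  apply: le_trans (ler_normD _ _) _; apply: lerD => //.
  by rewrite normrM; apply: ler_pM => //; rewrite ger0_norm.
by rewrite normrM; apply: ler_pM => //; rewrite ger0_norm.
Qed.


Definition value j q := phi (Hstar (nfst (nfst j))) (nsnd (nfst j)) (rprec j) q.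

Lemma value_fun j q q' : value j q -> value j q' -> q = q'.
Proof. exact: phi_fun. Qed.

(* Along the line of slope lam, p.rho moves fast enough at stage j to meet a
   multiple of 1/N without changing bit j. *)
Definition steep (lam : R) j := forall q, value j q -> good q ->
  64 / 2 ^+ mexp j <= `|(rho q).1 + lam * (rho q).2|.

(* A slope that is not steep from some stage on is the limit of the quotients
   - rho_1 / rho_2, so each program excludes at most one slope. *)
Lemma flat_slopes_subset1 i :
  is_subset1 [set lam : R | 0 <= lam <= 1 / 2 /\ exists k, forall l, (k <= l)%N -> ~ steep lam (npair i l)].
Proof.
move=> x y [x01 [k hk]] [y01 [k' hk']]; apply/eqP; apply: contraT => xy.
have xy0 : 0 < `|x - y| by rewrite normr_gt0 subr_eq0.
have [m hm] := exp2V_lt xy0.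
(* A stage past both thresholds and so late that 512/M is at most |x - y|. *)
set l := (k + k' + m + 8)%N; set j := npair i l.
have /hk hx : (k <= l)%N by rewrite /l; lia.
have /hk' hy : (k' <= l)%N by rewrite /l; lia.
have flat z : ~ steep z j -> exists q, [/\ value j q, good q &
    `|(rho q).1 + z * (rho q).2| < 64 / 2 ^+ mexp j].
  move=> h; apply: contrapT => hn; apply: h => q vq gq; rewrite leNgt; apply/negP => hlt.
  by apply: hn; exists q.
have [q [vq gq hq]] := flat _ hx; have [q' [vq' _]] := flat _ hy.
rewrite -(value_fun vq vq') => {vq' q'} hq'.
have jm : (m + 8 < mexp j)%N.
  by apply: leq_ltn_trans (mexp_ge j); have := (npair_ge i l).2; rewrite -/j /l; lia.
have M0 : 0 < (2 ^+ mexp j)^-1 :> R by rewrite invr_gt0 exprn_gt0.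
have Mm : 512 * (2 ^+ mexp j)^-1 <= 2 ^- m :> R.
  rewrite ler_pdivrMr ?exprn_gt0// ler_pdivlMl ?exprn_gt0// (_ : 512 = 2 ^+ 9); last by rewrite -natrX.
  by rewrite -exprD ler_eXn2l ?ltr1n//; lia.
have M1 : 2 ^- m <= 1 :> R by rewrite invf_le1 ?exprn_gt0// exprn_ege1// ler1n.
have /(@goodE R) [_ _ r12] := gq.
move: hq hq' r12; set a := (rho q).1; set b := (rho q).2; set i_ := (2 ^+ mexp j)^-1 in M0 Mm *.
move=> hq hq' r12.
(* Otherwise |a| would be at least 1/2, whereas |a + x b| < 1/8 and |x b| <= 1/4. *)
have b2 : 1 / 2 <= `|b|.
  case: r12 => // a2; rewrite leNgt; apply/negP => b2.
  have := ler_normB (a + x * b) (x * b); rewrite addrK [`|x * b|]normrM.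
  have /andP[x0 x1] := x01; rewrite (ger0_norm x0) => h.
  have := ler_pM x0 (normr_ge0 b) x1 (ltW b2); lra.
have : `|x - y| * `|b| < 128 * i_.
  rewrite -normrM (_ : _ * b = (a + x * b) - (a + y * b)); last by ring.
  apply: le_lt_trans (ler_normB _ _) _; lra.
have := ler_wpM2l (ltW xy0) b2; lra.
Qed.

(** The excluded slopes form a countable union of sets with at most one element, hence a null set,
    which cannot contain [0, 1/2]. *)
Lemma exists_steep_slope : exists lam : R, 0 <= lam <= 1 / 2 /\
  forall i k, exists l, steep lam (npair i (k + l)).
Proof.
pose S i := [set lam : R | 0 <= lam <= 1 / 2 /\ exists k, forall l, (k <= l)%N -> ~ steep lam (npair i l)].
have cS : countable (\bigcup_i S i).
  apply: bigcup_countable => // i _.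
  have [->|/set0P [x Sx]] := eqVneq (S i) set0; first exact: countable0.
  apply: (@sub_countable _ _ _ [set x]); last exact: countable1.
  by apply: subset_card_le => y Sy; rewrite (@flat_slopes_subset1 i x y Sx Sy).
apply: contrapT => hn.
have : [set` `[0, 1 / 2]] `<=` \bigcup_i S i.
  move=> lam; rewrite /= in_itv/= => l01; apply: contrapT => hS; apply: hn; exists lam; split=> // i k.
  apply: contrapT => hl; apply: hS; exists i => //; split=> //; exists k => l kl hs.
  by apply: hl; exists (l - k)%N; rewrite subnKC.
move=> /subset_card_le /sub_countable /(_ cS) /countable_lebesgue_measure0.
rewrite lebesgue_measure_itv/= lte_fin ifT; last by lra.
by rewrite -EFinB => -[]; lra.
Qed.

Lemma witness_set_projects_onto : exists lam : R, 0 <= lam <= 1 / 2 /\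
  forall t : R, 0 <= t <= 1 / 2 -> exists2 p, witness_set p & p.2 - lam * p.1 = t.
Proof.
have [lam [l01 hlam]] := exists_steep_slope; exists lam; split=> // t t01.
(* The point codes the true H-sets and chooses exactly the stages where [lam] is steep; the choice
   of [lam] provides infinitely many for every pair. *)
pose bit v := `[< model (steep lam) v >].
have [u [usq hbit hgrid]] := @exists_point R lam t bit (steep lam) value l01 t01 value_fun
  (fun j q h => h q).
exists (u, t + lam * u); last by rewrite /= addrK.
apply/witness_setE; split=> //; apply: (@model_sat _ (steep lam)) => [v hv|v hv|a c k|a c l q j hj hq].
- by have := hbit v; rewrite /bit asboolT.
- by have := hbit v; rewrite /bit asboolF.
- exact: hlam.
- by apply: hgrid => //; rewrite /value /j !npairE.
Qed.

End Projections.

(** * Computation of the dimensions *)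

Section Dimension.
Context {R : realType}.

Lemma dist1_ge0 (x y : R) : 0 <= dist1 x y.
Proof. exact: normr_ge0. Qed.

Lemma dist2_ge0 (x y : R * R) : 0 <= dist2 x y.
Proof. exact: sqrtr_ge0. Qed.

(** The multiples z/N indexed by natural numbers: i = z + 4 N. A grid value near a number of modulus
    at most 2 has modulus below 4, so 8 N indices suffice. *)
Definition gridpoint j i : R := (i%:R - (2 ^ (nexp j + 2))%:R) / 2 ^+ nexp j.

Lemma gridpoint_index j (x : R) (z : int) : `|x| <= 2 ->
  `|x - z%:~R / 2 ^+ nexp j| <= 17 / 2 ^+ kexp j ->
  exists2 i, (i < 2 ^ (nexp j + 3))%N & z%:~R / 2 ^+ nexp j = gridpoint j i.
Proof.
move=> x2 hz; have N0 : (0 : R) < 2 ^+ nexp j by rewrite exprn_gt0.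
have L0 : (0 : R) < 2 ^+ kexp j by rewrite exprn_gt0.
have L16 : 17 / 2 ^+ kexp j <= 17 / 16 :> R.
  rewrite ler_pM2l// lef_pV2 ?posrE// (_ : 16 = 2 ^+ 4); last by rewrite -natrX.
  by rewrite ler_eXn2l ?ltr1n// kexp_ge4.
set W := (2 ^ (nexp j + 2))%N.
have WE : W%:R = 4 * 2 ^+ nexp j :> R by rewrite /W natrX exprD mulrC -natrX.
have : `|z%:~R : R| < W%:R.
  rewrite WE -ltr_pdivrMr// -{1}(gtr0_norm N0) -normfV -normrM.
  have := ler_normB x (x - z%:~R / 2 ^+ nexp j); rewrite opprB addrC subrK.
  by move: hz; set y := `|_ / _|; lra.
rewrite -intr_norm pmulrn ltr_int => zW.
exists (absz (z + W%:Z)).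
  by rewrite -ltz_nat gez0_abs; [rewrite addnS expnS -/W; lia|lia].
rewrite /gridpoint -/W; congr (_ / _).
rewrite [X in X - _]pmulrn gez0_abs; last by lia.
by rewrite intrD -pmulrn addrK.
Qed.

Lemma hausdorff_dim_dirproj (e : R * R) : hyperarithmetic_direction e ->
  hausdorff_dim dist1 (dirproj e witness_set) = 0%E.
Proof.
move=> he; apply/eqP; rewrite eq_le; apply/andP; split; last first.
  by apply: le_ereal_inf_tmp => _ [s [s0 _] <-]; rewrite lee_fin.
apply/lee_addgt0Pr => s s0; rewrite add0e; apply: ereal_inf_lbound; exists s => //; split; first exact: ltW.
(* The count 16 N instead of 8 N lets [mesh_rate] serve this cover and the planar one. *)
apply: (@limsup_hausdorff_measure0 _ _ _ dist1_ge0 _ (fun j => 2 ^ (nexp j + 4 + 0 * kexp j))%N mesh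
  (fun j i => [set x | `|x - gridpoint j i| <= 17 / 2 ^+ kexp j])).
- exact: ltW.
- exact: mesh_ge0.
- move=> j i _; apply: diam_le => x y /= hx hy; rewrite /dist1 /mesh.
  have := ler_normB (x - gridpoint j i) (y - gridpoint j i).
  rewrite opprB addrA subrK.
  by have : 0 < (2 ^+ kexp j)^-1 :> R by [rewrite invr_gt0 exprn_gt0|]; lra.
- by move=> m; exact: (@mesh_rate R 0%N).
- move=> _ [p pB <-] k; have [j [kj [z hz]]] := liouville_projection he pB k.
  have [i iN zE] : exists2 i, (i < 2 ^ (nexp j + 3))%N & z%:~R / 2 ^+ nexp j = gridpoint j i.
    apply: gridpoint_index hz; move: he pB => [edir _] [_ [/andP[a1 a2] /andP[b1 b2]]].
    have [x1 x2] := (sqr_ge0 e.1, sqr_ge0 e.2).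
    have e1 : `|e.1| <= 1 by rewrite ler_norml; move: edir; rewrite /direction => ?; apply/andP; split; nra.
    have e2 : `|e.2| <= 1 by rewrite ler_norml; move: edir; rewrite /direction => ?; apply/andP; split; nra.
    apply: le_trans (ler_normD _ _) _; rewrite !normrM (ger0_norm a1) (ger0_norm b1).
    have := ler_pM a1 (normr_ge0 _) a2 e1; have := ler_pM b1 (normr_ge0 _) b2 e2; lra.
  exists j, i; split=> //; last by rewrite /= -zE.
  by apply: leq_trans iN _; rewrite leq_exp2l //; lia.
Qed.

Lemma hyperarithmetic_horizontal : hyperarithmetic_direction ((1, 0) : R * R).
Proof.
split; first by rewrite /direction /= expr1n expr0n addr0.
exists set0; split.
- exists 1%N, set0; split; [exact: kleeneO_zero|exact: Hset_zero|].
  by exists cOracle => n; split=> // h; right.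
- exists (fun=> ratc 1 0); split; first exact: recursive_const.
  by move=> n; rewrite ratcode_ratc divr1 subrr normr0 invr_ge0 exprn_ge0.
- exists (fun=> ratc 0 0); split; first exact: recursive_const.
  by move=> n; rewrite ratcode_ratc mul0r subrr normr0 invr_ge0 exprn_ge0.
Qed.

(** Projecting along (1, 0) places p.1 near one of 8 N grid values; cutting p.2 at mesh 1/L leaves
    about N L squares of side about 1/L. *)
Lemma hausdorff_dim_witness_set_le1 : (hausdorff_dim dist2 (@witness_set R) <= 1)%E.
Proof.
apply/lee_addgt0Pr => eps eps0; apply: ereal_inf_lbound; exists (1 + eps) => //.
split; first by rewrite addr_ge0// ltW.
(* Column and row are packed as i K + y. The row y may equal L when p.2 = 1, so K = 2 L is taken. *)
pose K j := (2 ^ (kexp j).+1)%N.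
apply: (@limsup_hausdorff_measure0 _ _ _ dist2_ge0 _ (fun j => 2 ^ (nexp j + 4 + 1 * kexp j))%N mesh
  (fun j i => [set p | `|p.1 - gridpoint j (i %/ K j)| <= 17 / 2 ^+ kexp j /\
                       `|p.2 - (i %% K j)%:R / 2 ^+ kexp j| <= 1 / 2 ^+ kexp j])).
- by rewrite addr_ge0// ltW.
- exact: mesh_ge0.
- move=> j i _; apply: diam_le => x y /= [hx hx'] [hy hy'].
  apply: le_trans (dist2_le _ _) _; rewrite /mesh.
  set g := gridpoint _ _ in hx hy; set g' := _ / _ in hx' hy'.
  have := ler_normB (x.1 - g) (y.1 - g); have := ler_normB (x.2 - g') (y.2 - g').
  rewrite !opprB !addrA !subrK.
  by have : 0 < (2 ^+ kexp j)^-1 :> R by [rewrite invr_gt0 exprn_gt0|]; lra.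
- by move=> m; apply: (@mesh_rate R 1%N); rewrite ltrDl.
- move=> p pB k; have [j [kj [z]]] := liouville_projection hyperarithmetic_horizontal pB k.
  rewrite /= mulr1 mulr0 addr0 => hz.
  have [_ [/andP[a1 a2] /andP[b1 b2]]] := pB.
  have [i iN zE] := @gridpoint_index j p.1 z ltac:(rewrite ger0_norm //; lra) hz.
  have L0 : (0 < 2 ^ kexp j)%N by rewrite expn_gt0.
  have := truncn_approx b1 L0; set y := Num.truncn _ => hy.
  have yK : (y < K j)%N.
    rewrite /K expnS -(ltr_nat R) natrM natrX.
    have /andP[h1 _] := truncn_itv (mulr_ge0 b1 (ltW (eqbRL (ltr0n R _) L0))).
    apply: le_lt_trans h1 _; rewrite natrX.
    have : (0 : R) < 2 ^+ kexp j by rewrite exprn_gt0.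
    nra.
  exists j, (i * K j + y)%N; split=> //.
    have : (i * K j + y < i.+1 * K j)%N by rewrite mulSn addnC ltn_add2r.
    move/leq_trans; apply; apply: (@leq_trans (2 ^ (nexp j + 3) * K j)%N); first by rewrite leq_mul2r iN orbT.
    by rewrite -expnD leq_exp2l//; lia.
  rewrite /= divnMDl ?expn_gt0// divn_small// addn0 modnMDl modn_small// -zE; split=> //.
  by rewrite -natrX ltW.
Qed.

(** For s < 1 a null [s]-measure would give a cover of total cost below 1/16. The map p.2 - lam p.1
    sends a piece of diameter r <= 1 into an interval of length 4 r <= 4 r^s, so the images would
    have total length below 1/4, yet they cover [0, 1/2]. *)
Lemma hausdorff_dim_witness_set_ge1 : (1 <= hausdorff_dim dist2 (@witness_set R))%E.
Proof.
apply: le_ereal_inf_tmp => _ [s [s0 hs] <-]; rewrite lee_fin leNgt; apply/negP => s1.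
have [lam [/andP[l0 l1] honto]] := @witness_set_projects_onto R.
have : (hausdorff_premeasure dist2 s 1 (@witness_set R) < (1 / 16)%:E)%E.
  apply: (@le_lt_trans _ _ 0%E); last by rewrite lte_fin.
  by rewrite -hs; apply: ereal_sup_ubound; exists 1 => //=.
move=> /ereal_inf_lt [_ [U [BU dU] <-] hU].
pose f (p : R * R) := p.2 - lam * p.1.
have fine_diam i : U i !=set0 -> diam dist2 (U i) = (fine (diam dist2 (U i)))%:E.
  move=> U0; rewrite fineK// ge0_fin_numE; last exact/diam_ge0/U0/dist2_ge0.
  by apply: le_lt_trans (dU i) _; rewrite ltry.
have hJ i : exists J : set R, [/\ @measurable _ (measurableTypeR R) J, f @` U i `<=` J &
    (lebesgue_measure J <= 4%:E * hcost dist2 s (U i))%E].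
  have [U0|/set0P U0] := eqVneq (U i) set0.
    exists set0; split=> //; first by rewrite U0 image_set0.
    by rewrite measure0 mule_ge0// hcost_ge0.
  have [x Ux] := U0; set r := fine (diam dist2 (U i)).
  have r0 : 0 <= r by rewrite -lee_fin -fine_diam//; exact/diam_ge0/U0/dist2_ge0.
  have r1 : r <= 1 by rewrite -lee_fin -fine_diam.
  exists [set` `[f x - 2 * r, f x + 2 * r]]; split=> //.
    move=> _ [y Uy <-] /=; rewrite in_itv/= -ler_distl.
    have hd : dist2 y x <= r.
      by rewrite -lee_fin -fine_diam//; apply: ereal_sup_ubound; exists y => //; exists x.
    have -> : f y - f x = (y.2 - x.2) - lam * (y.1 - x.1) by rewrite /f; ring.
    apply: le_trans (ler_normB _ _) _; rewrite normrM (ger0_norm l0).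
    have h1 := le_trans (dist2_ge1 y x) hd; have h2 := le_trans (dist2_ge2 y x) hd.
    have := normr_ge0 (y.1 - x.1); nra.
  rewrite lebesgue_measure_itv/= lte_fin; case: ifPn => _; last first.
    by rewrite mule_ge0// hcost_ge0.
  rewrite /hcost ifF; last by apply/negbTE/set0P.
  rewrite fine_diam// -/r poweR_EFin -EFinB -EFinM lee_fin.
  rewrite (_ : _ - _ = 4 * r); last by ring.
  rewrite ler_wpM2l//; have [->|rn0] := eqVneq r 0; first exact: powR_ge0.
  by apply: ger1_powR (ltW s1); rewrite lt_neqAle eq_sym rn0 r0.
have [J hJJ] := choice hJ.
have cover : [set` `[0 : R, 1 / 2]] `<=` \bigcup_i J i.
  move=> t; rewrite /= in_itv/= => /honto [p /BU [i _ Ui] <-]; exists i => //.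
  by have [_ + _] := hJJ i; apply; exists p.
have mJ i : @measurable _ (measurableTypeR R) (J i) by have [] := hJJ i.
have : (lebesgue_measure ([set` `[0%R, (1 / 2)%R]] : set R) <= \sum_(0 <= i <oo) lebesgue_measure (J i))%E.
  exact: (measure_sigma_subadditive (@lebesgue_measure R) mJ (measurable_itv _) cover).
rewrite lebesgue_measure_itv/= lte_fin ifT; last by lra.
move=> h.
have : ((1 / 2)%:E - 0%:E <= 4%:E * (1 / 16)%:E :> \bar R)%E.
  apply: le_trans h _; apply: (@le_trans _ _ (4%:E * \sum_(0 <= i <oo) hcost dist2 s (U i))%E).
    rewrite -nneseriesZl//; last by move=> i _; exact: hcost_ge0.
    by apply: lee_nneseries => // i _; have [] := hJJ i.
  by rewrite lee_pmul2l ?lte_fin// ltW.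
by rewrite -EFinB -EFinM lee_fin; lra.
Qed.

End Dimension.

Theorem theorem3p1 (R : realType) :
  exists B : set (R * R),
    lightface_Pi02 B /\
    hausdorff_dim dist2 B = 1%E /\
    forall e : R * R, hyperarithmetic_direction e ->
      hausdorff_dim dist1 (dirproj e B) = 0%E.
Proof.
exists witness_set; split; first exact: lightface_witness_set.
split; last exact: hausdorff_dim_dirproj.
apply/eqP; rewrite eq_le hausdorff_dim_witness_set_le1.
exact: hausdorff_dim_witness_set_ge1.
Qed.
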